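(* Let $\Omega=\{(\tau(C),\phi(C),\beta(C)):C\in\mathcal{C}\}\subseteq\mathbb{R}^3$, where $\mathcal{C}$ is the class of all bivariate copulas and $\tau,\phi,\beta$ are Kendall's tau, Spearman's footrule and Blomqvist's beta. Call a pair $(p,b)\in\mathbb{R}^2$ admissible if $-1\le b\le1$ and $\tfrac{3}{16}(1+b)^2-\tfrac12\le p\le 1-\tfrac38(1-b)^2$. Then: (i) for every admissible pair $(p,b)$, the fibre $\{t\in\mathbb{R}:(t,p,b)\in\Omega\}$ equals the interval $\bigl[p-\tfrac{1-p}{3},\,p+\tfrac{1-p}{3}\bigr]$, which is symmetric about $t=p$ and has length $\tfrac23(1-p)$, depending on $p$ alone; (ii) for every admissible pair $(p,b)$ there exists a copula $C\in\mathcal{C}$ with $\tau(C)=\phi(C)=p$ and $\beta(C)=b$; (iii) $\Omega$ is invariant under the affine involution $(t,p,b)\mapsto(2p-t,p,b)$ of $\mathbb{R}^3$.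
   Context: A (bivariate) copula is a distribution function $C$ on $[0,1]^2$ with uniform marginals; it induces a probability measure on $[0,1]^2$, and integrals $\int \cdot\,\mathrm{d}C$ are Lebesgue--Stieltjes integrals with respect to this measure. For a copula $C$: Kendall's tau is $\tau(C)=4\int_{[0,1]^2}C(u,v)\,\mathrm{d}C(u,v)-1$; Spearman's footrule is $\phi(C)=6\int_0^1 C(u,u)\,\mathrm{d}u-2$; Blomqvist's beta is $\beta(C)=4C(\tfrac12,\tfrac12)-1$. *)

(* Defs.v *)
From HB Require Import structures.
From mathcomp Require Import all_boot all_order all_algebra.
From mathcomp Require Import all_classical all_reals all_analysis.

Set Implicit Arguments.
Unset Strict Implicit.
Unset Printing Implicit Defensive.

Import Order.TTheory GRing.Theory Num.Theory.
Import numFieldNormedType.Exports.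

Local Open Scope classical_set_scope.
Local Open Scope ring_scope.

Definition unit_square (R : realType) : set (R * R) := `[0, 1] `*` `[0, 1].

(* A distribution function on the unit square is packaged with the Borel
   probability measure it induces.  The measure is no additional datum: by
   [copula_cdf] and [copula_law_square], [copula_fun] determines it on a
   generating pi-system.  Only the values of [copula_fun] on the unit square
   are meaningful. *)
Record copula (R : realType) := Copula {
  copula_fun :> R -> R -> R;
  copula_law : probability (measurableTypeR R * measurableTypeR R)%type R;
  copula_law_square : copula_law (@unit_square R) = 1%E;
  copula_cdf : forall u v : R, 0 <= u <= 1 -> 0 <= v <= 1 ->
    copula_law (`[0, u] `*` `[0, v]) = (copula_fun u v)%:E;
  copula_margin1 : forall u : R, 0 <= u <= 1 -> copula_fun u 1 = u;
  copula_margin2 : forall v : R, 0 <= v <= 1 -> copula_fun 1 v = v }.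

Section Measures_of_association.
Context {R : realType}.
Implicit Type C : copula R.

Definition kendall_tau C : R :=
  4 * (\int[copula_law C]_(w in @unit_square R) C w.1 w.2) - 1.

Definition spearman_footrule C : R :=
  6 * (\int[lebesgue_measure]_(u in `[0, 1]) C u u) - 2.

Definition blomqvist_beta C : R := 4 * C (1 / 2) (1 / 2) - 1.

End Measures_of_association.

(* Points of R^3 are triples ((t, p), b). *)
Definition Omega (R : realType) : set (R * R * R) :=
  [set (kendall_tau C, spearman_footrule C, blomqvist_beta C)
  | C in [set: copula R]].

Definition Omega_fibre (R : realType) (p b : R) : set R :=
  [set t | Omega (t, p, b)].

Definition admissible (R : realType) (p b : R) : Prop :=
  -1 <= b <= 1 /\
  3 / 16 * (1 + b) ^+ 2 - 1 / 2 <= p <= 1 - 3 / 8 * (1 - b) ^+ 2.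

Definition tau_reflection (R : realType) (x : R * R * R) : R * R * R :=
  let: (t, p, b) := x in (2 * p - t, p, b).

(* Main.v *)
(* Let (U, V) have law C.  Then 1 - phi = 3 E|U - V|, equivalently
   E min(U, V) is the integral of the diagonal section (Fubini).  The bounds on
   tau are the continuous Diaconis-Graham inequalities: integrating
   C(u, v) <= min(u, v) against C gives the upper one, and integrating
   C(u, v) >= C(u, u) - (u - v)^+ gives the lower one.  Admissibility of
   (phi, beta) is the Lipschitz property of the diagonal section.

   Both bounds are attained, for every admissible pair, by copulas carried by
   the graph of a piecewise isometric involution of [0, 1]: one that moves
   blocks by translations (a continuous 321-avoiding permutation) for the upper
   bound, one made of nested or disjoint reflections for the lower bound.  Along
   the segment joining two such copulas with the same phi and beta, tau is a
   polynomial of degree two, so it takes all intermediate values. *)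
Require Import Defs.
From HB Require Import structures.
From mathcomp Require Import all_boot all_order all_algebra.
From mathcomp Require Import all_classical all_reals all_analysis.
From mathcomp Require Import measurable_realfun.
From mathcomp Require Import ring lra.

Set Implicit Arguments.
Unset Strict Implicit.
Unset Printing Implicit Defensive.

Import Order.TTheory GRing.Theory Num.Theory.
Import numFieldNormedType.Exports.

Local Open Scope classical_set_scope.
Local Open Scope ring_scope.

(** * Integrals of piecewise affine functions *)

(** Both extremal families share two parameters. If m is the mass that crosses the level 1/2
    upwards, then C(1/2, 1/2) = 1/2 - m, that is, b = 1 - 4m. With block sizes t = r - 2m and s =
    r/2 - m, both families have mean displacement E|U - V| = r^2 - 2m^2. That the blocks have
    nonnegative size (r >= 2m) and fit into [0, 1] (r <= 1/2 + m) are exactly the upper and the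
    lower admissibility inequality for p.

    Involutions are convenient for three reasons. A law carried by the graph of T has a uniform
    second margin once T preserves Lebesgue measure, which a finite exchange of isometric pieces
    does. A point and its image play symmetric roles in the order arguments. Finally, E min(U, V)
    becomes the integral of min(x, T x), a piecewise affine function of one variable. The maps are
    defined on all of R and satisfy T (T x) = x at every point, so that only the comparison with
    explicit step functions has to discard finitely many points. *)

Lemma bounded_integrable d (T : measurableType d) (R : realType)
    (mu : {measure set T -> \bar R}) (D : set T) (f : T -> R) (K : R) :
  measurable D -> (mu D < +oo)%E -> measurable_fun D f ->
  (forall x, D x -> `|f x| <= K) -> mu.-integrable D (EFin \o f).
Proof.
move=> mD muD mf fK; apply: measurable_bounded_integrable => //.
exists K; split; first by rewrite num_real.
by move=> M KM x Dx /=; rewrite (le_trans (fK _ Dx))// ltW.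
Qed.

Lemma lebesgue01_lty (R : realType) :
  (@lebesgue_measure R `[0%R, 1%R]%classic < +oo)%E.
Proof. by rewrite lebesgue_measure_itv/= lte_fin ltr01 -EFinB ltry. Qed.

Lemma integral_affine (R : realType) (a b c e : R) : a <= b ->
  \int[lebesgue_measure]_(x in `[a, b]) (c * x + e) =
  c * (b ^+ 2 - a ^+ 2) / 2 + e * (b - a).
Proof.
rewrite le_eqVlt => /predU1P[->|ab].
  by rewrite set_itv1 Rintegral_set1; ring.
pose F : {poly R} := (c / 2) *: ('X * 'X) + e *: 'X.
have F'E x : (deriv F).[x] = c * x + e.
  by rewrite /F !poly.derivE !hornerE /=; field.
have FE x : F.[x] = c / 2 * (x * x) + e * x.
  by rewrite /F hornerD !hornerZ hornerM hornerX.
rewrite /Rintegral (@continuous_FTC2 _ _ (fun x => F.[x])) //=.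
- by rewrite !FE; field.
- have -> : (fun x => c * x + e) = (fun x => (deriv F).[x]).
    by apply/funext => x; rewrite F'E.
  exact/continuous_subspaceT/continuous_horner.
- split=> [x _| |].
  + exact: derivable_horner.
  + by apply: cvg_at_right_filter; exact: continuous_horner.
  + by apply: cvg_at_left_filter; exact: continuous_horner.
- by move=> x _; rewrite -derivE F'E.
Qed.

(* An entry [(a, c, e)] of [l] contributes [c * x + e] from [a] onwards. *)
Definition step_affine {R : realType} (l : seq (R * R * R)) (x : R) : R :=
  \sum_(h <- l) if h.1.1 <= x then h.1.2 * x + h.2 else 0.

Lemma measurable_step (R : realType) (h : R * R * R) :
  measurable_fun setT (fun x : R => if h.1.1 <= x then h.1.2 * x + h.2 else 0).
Proof.
apply: measurable_fun_if => //=.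
- exact: measurable_fun_ler.
- by apply: measurable_funTS; apply: measurable_funD => //; exact: measurable_funM.
Qed.

Lemma integrable_step (R : realType) (h : R * R * R) :
  lebesgue_measure.-integrable `[0, 1]
    (EFin \o (fun x : R => if h.1.1 <= x then h.1.2 * x + h.2 else 0)).
Proof.
apply: (@bounded_integrable _ _ _ _ _ _ (`|h.1.2| + `|h.2|)) => //.
- exact: lebesgue01_lty.
- by apply: measurable_funTS; exact: measurable_step.
- move=> x; rewrite /= in_itv/= => /andP[x0 x1]; case: ifPn => _.
    rewrite (le_trans (ler_normD _ _))// lerD2r normrM (ger0_norm x0).
    by rewrite ler_piMr.
  by rewrite normr0 addr_ge0.
Qed.

Lemma integral_step (R : realType) (h : R * R * R) : 0 <= h.1.1 <= 1 ->
  \int[lebesgue_measure]_(x in `[0, 1])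
    (if h.1.1 <= x then h.1.2 * x + h.2 else 0) =
  h.1.2 * (1 - h.1.1 ^+ 2) / 2 + h.2 * (1 - h.1.1).
Proof.
case: h => [[a c] e] /= /andP[a0 a1].
rewrite -[X in X - a ^+ 2](expr1n R 2) -integral_affine//.
have -> : `[a, 1]%classic = `[0, 1]%classic `&` [set x | a <= x].
  apply/seteqP; split => x /=; rewrite !in_itv/=.
    by move=> /andP[ax ->]; rewrite ax (le_trans a0 ax).
  by move=> [/andP[_ ->] ->].
rewrite Rintegral_mkcondr; apply: eq_Rintegral => x _.
rewrite patchE; case: ifPn => ax; first by rewrite mem_set.
by rewrite memNset//= ; exact/negP.
Qed.

Lemma integrable_step_affine (R : realType) (l : seq (R * R * R)) :
  lebesgue_measure.-integrable `[0, 1] (EFin \o step_affine l).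
Proof.
elim: l => [|h l IH].
  rewrite (_ : _ \o _ = cst 0%E); first exact: integrable0.
  by apply/funext => x; rewrite /step_affine /= big_nil.
rewrite (_ : _ \o _ = (EFin \o (fun x : R => if h.1.1 <= x then h.1.2 * x + h.2
    else 0)%R) \+ (EFin \o step_affine l))%E.
  by apply: integrableD => //; exact: integrable_step.
by apply/funext => x; rewrite /step_affine /= big_cons.
Qed.

Lemma integral_step_affine (R : realType) (l : seq (R * R * R)) :
  all (fun h => 0 <= h.1.1 <= 1) l ->
  \int[lebesgue_measure]_(x in `[0, 1]) step_affine l x =
  \sum_(h <- l) (h.1.2 * (1 - h.1.1 ^+ 2) / 2 + h.2 * (1 - h.1.1)).
Proof.
elim: l => [_|h l IH /= /andP[h01 l01]].
  rewrite big_nil (@eq_Rintegral _ _ _ _ _ (fun=> 0)) ?Rintegral_cst ?mul0r//.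
  by move=> x _; rewrite /step_affine big_nil.
rewrite big_cons -IH// -integral_step// -RintegralD//.
- by apply: eq_Rintegral => x _; rewrite /step_affine big_cons.
- exact: integrable_step.
- exact: integrable_step_affine.
Qed.

(** The points of [E] are breakpoints: every step of [step_affine] starts at a closed left end,
    whereas the functions integrated later may follow the other convention there. A finite set is
    Lebesgue null. *)
Lemma integral_eq_step_affine (R : realType) (f : R -> R) (E : seq R)
    (l : seq (R * R * R)) :
  all (fun h => 0 <= h.1.1 <= 1) l -> measurable_fun (`[0, 1]%classic : set R) f ->
  (forall x, 0 <= x <= 1 -> x \notin E -> f x = step_affine l x) ->
  \int[lebesgue_measure]_(x in `[0, 1]) f x =
  \sum_(h <- l) (h.1.2 * (1 - h.1.1 ^+ 2) / 2 + h.2 * (1 - h.1.1)).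
Proof.
move=> l01 mf fl; rewrite -integral_step_affine//; congr fine.
apply: ae_eq_integral => //.
- exact/measurable_EFinP.
- by have /integrableP[] := integrable_step_affine l.
have cE : countable [set` E] by apply: finite_set_countable; exact: finite_seq.
exists [set` E]; split.
- exact: countable_measurable.
- exact: countable_lebesgue_measure0.
move=> x /=; apply: contra_notP => xE; rewrite in_itv/= => x01.
by rewrite fl//; exact/negP.
Qed.

(** * Uniform margins *)

Lemma measure_setI_conull d (T : measurableType d) (R : realType)
    (m : {measure set T -> \bar R}) (S A : set T) :
  measurable S -> measurable A -> m (~` S) = 0%E -> m (A `&` S) = m A.
Proof.
move=> mS mA mS0; rewrite [RHS](measureDI m mA mS).
rewrite [X in (X + _)%E](@subset_measure0 _ _ _ _ _ (~` S)) ?add0e//.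
- exact: measurableD.
- exact: measurableC.
Qed.

Lemma eq_Rintegral_full d (T : measurableType d) (R : realType)
    (P : probability T R) (S D : set T) (f g : T -> R) :
  measurable S -> measurable D -> P S = 1%E ->
  measurable_fun D f -> measurable_fun D g ->
  (forall x, D x -> S x -> f x = g x) ->
  \int[P]_(x in D) f x = \int[P]_(x in D) g x.
Proof.
move=> mS mD PS1 mf mg fg; congr fine; apply: ae_eq_integral => //.
- exact/measurable_EFinP.
- exact/measurable_EFinP.
have PS0 : P (~` S) = 0%E by rewrite probability_setC// PS1 subee.
exists (~` S); split; [exact: measurableC | exact: PS0 |].
by move=> x /= /not_implyP[Dx fgx] Sx; apply: fgx => /=; rewrite (fg _ Dx Sx).
Qed.

Lemma measurable_unit_square (R : realType) :
  measurable (@unit_square R : set (measurableTypeR R * measurableTypeR R)).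
Proof. by apply: measurableX; exact: measurable_itv. Qed.
#[local] Hint Resolve measurable_unit_square : core.

Lemma lebesgue_itvcc (R : realType) (a b : R) : a <= b ->
  lebesgue_measure (`[a, b]%classic : set R) = (b - a)%:E.
Proof.
rewrite lebesgue_measure_itv/= lte_fin le_eqVlt => /predU1P[->|->].
  by rewrite ltxx subrr.
by rewrite -EFinB.
Qed.

(** The right-hand side does not depend on [m], so any two measures with these properties agree on
    all rays, hence on all half-open intervals. *)
Lemma finite_measure_ray (R : realType)
    (m : {finite_measure set (measurableTypeR R) -> \bar R}) (x : R) :
  (forall u, 0 <= u <= 1 -> m `[0, u]%classic = u%:E) ->
  m (~` `[0, 1]%classic) = 0%E ->
  m `]-oo, x]%classic = (Num.max 0 (Num.min x 1))%:E.
Proof.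
move=> m01 mC.
pose I : set R := `[0, 1]%classic.
have mx : m `]-oo, x]%classic = m (`]-oo, x]%classic `&` I).
  by rewrite measure_setI_conull//; exact: measurable_itv.
have [x0|x0] := ltP x 0.
  rewrite mx (_ : _ `&` _ = set0) ?measure0.
    by rewrite min_l ?max_l//; lra.
  apply/seteqP; split => // y [] /=; rewrite /I/= !in_itv/= => yx /andP[y0 _].
  by move: (le_lt_trans yx x0); rewrite ltNge y0.
rewrite mx max_r; last by rewrite le_min x0 ler01.
rewrite -m01 ?le_min ?x0 ?ler01 ?ge_min ?lexx ?orbT//.
congr (m _); apply/seteqP; split => y; rewrite /I/= !in_itv/= le_min.
  by move=> [-> /andP[-> ->]].
by move=> /andP[-> /andP[-> ->]].
Qed.

Lemma uniform_prob01E (R : realType) (A : set R) : measurable A ->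
  uniform_prob (@ltr01 R) A = lebesgue_measure (A `&` `[0, 1]%classic).
Proof.
move=> mA; rewrite /uniform_prob integral_uniform_pdf.
rewrite (eq_integral (cst 1%E)); last first.
  by move=> x; rewrite inE/= in_itv/= /uniform_pdf => -[_ ->]; rewrite subr0 invr1.
rewrite integral_cst ?mul1e//; apply: measurableI => //.
Qed.

Lemma finite_measure_lebesgue01 (R : realType)
    (m : {finite_measure set (measurableTypeR R) -> \bar R}) (A : set R) :
  (forall u, 0 <= u <= 1 -> m `[0, u]%classic = u%:E) ->
  m (~` `[0, 1]%classic) = 0%E ->
  measurable A -> A `<=` `[0, 1]%classic -> m A = lebesgue_measure A.
Proof.
move=> m01 mC mA AI; pose I : set (measurableTypeR R) := `[0, 1]%classic.
have mI : measurable I by exact: measurable_itv.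
(* The uniform law is the reference measure: it satisfies the same two hypotheses as [m], and its
   value on a set is the length of the part inside [0, 1]. *)
pose l' := uniform_prob (@ltr01 R).
have l01 u : 0 <= u <= 1 -> l' `[0, u]%classic = u%:E.
  move=> /andP[u0 u1]; rewrite /l' uniform_prob01E// setIidl; last first.
    by apply: subset_itvl; rewrite bnd_simp.
  by rewrite lebesgue_itvcc// subr0.
have lC : l' (~` `[0, 1]%classic) = 0%E.
  by rewrite /l' uniform_prob01E ?setICl ?measure0//; exact: measurableC.
have oc (k : {finite_measure set (measurableTypeR R) -> \bar R}) (a b : R) :
    a <= b ->
    k `]a, b]%classic = (k `]-oo, b]%classic - k `]-oo, a]%classic)%E.
  move=> ab; have -> : `]a, b]%classic = `]-oo, b]%classic `\` `]-oo, a]%classic.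
    apply/seteqP; split => x /=; rewrite !in_itv/=.
      by move=> /andP[ax ->]; split => //; apply/negP; rewrite -ltNge.
    by move=> [-> /negP]; rewrite -ltNge => ->.
  rewrite measureD//= ?setIidr//; first by apply: subset_itvl; rewrite bnd_simp.
  by rewrite -ge0_fin_numE ?measure_ge0// fin_num_measure.
have ml (a b : R) : m `]a, b]%classic = lebesgue_measure (`]a, b]%classic `&` I).
  have [ab|ba] := leP a b; last by rewrite set_itv_ge ?set0I ?measure0// bnd_simp -leNgt ltW.
  rewrite -uniform_prob01E// !oc//.
  by rewrite !finite_measure_ray.
(* Uniqueness of Lebesgue measure speaks of half-open intervals of the whole line, so [m] is first
   completed by Lebesgue measure outside [0, 1]. *)
pose n := mrestr lebesgue_measure (measurableC mI).
transitivity (measure_add m n A); last first.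
  apply: esym; apply: lebesgue_measure_unique => // _ [[a b] _ <-].
  rewrite -[RHS]/(measure_add m n `]a, b]%classic) measure_addE.
  rewrite -[LHS]/(lebesgue_measure `]a, b]%classic).
  rewrite [LHS](@measureDI _ _ _ _ _ I)// addeC; congr (_ + _)%E; exact/esym/ml.
have nA : n A = 0%E.
  rewrite -[LHS]/(lebesgue_measure (A `&` ~` I)).
  have -> : A `&` ~` I = set0 by apply/seteqP; split => // x [/AI].
  exact: measure0.
transitivity (m A + n A)%E; first by rewrite nA adde0.
exact/esym/measure_addE.
Qed.

Lemma integral_uniform_margin d (T : measurableType d) (R : realType)
    (P : probability T R) (D : set T) (X : T -> measurableTypeR R)
    (g : R -> R) :
  measurable D -> P D = 1%E -> (forall w, D w -> 0 <= X w <= 1) ->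
  measurable_fun setT X ->
  (forall u, 0 <= u <= 1 -> P (X @^-1` `[0, u]%classic) = u%:E) ->
  measurable_fun (`[0, 1]%classic : set R) g ->
  (forall x, 0 <= x <= 1 -> 0 <= g x) ->
  \int[P]_(w in D) g (X w) = \int[lebesgue_measure]_(x in `[0, 1]) g x.
Proof.
move=> mD PD DX mX PX mg g0; congr fine.
have mXI (A : set (measurableTypeR R)) : measurable A -> measurable (X @^-1` A).
  by move=> mA; rewrite -[Y in measurable Y]setTI; exact: mX.
pose mX' := isMeasurableFun.Build _ _ _ _ X mX.
pose XX : {mfun T >-> measurableTypeR R} := HB.pack X mX'.
pose m := distribution P XX.
have mI : measurable (`[0, 1]%classic : set (measurableTypeR R)) by exact: measurable_itv.
have mC : m (~` `[0, 1]%classic) = 0%E.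
  rewrite -[LHS]/(P (~` (X @^-1` `[0, 1]%classic))) probability_setC.
    by rewrite PX ?subee// ler01 lexx.
  exact: mXI.
transitivity (\int[m]_(x in `[0%R, 1%R]%classic) (g x)%:E)%E; last first.
  apply: eq_measure_integral => A mA AI.
  exact: finite_measure_lebesgue01.
rewrite ge0_integral_pushforward//; last 2 first.
  - exact/measurable_EFinP.
  - by move=> x; rewrite inE/= in_itv/= lee_fin; exact: g0.
have PD0 : P (~` D) = 0%E by rewrite probability_setC// PD subee.
have mgX : measurable_fun (X @^-1` `[0, 1]%classic) (EFin \o g \o X).
  apply: (@measurable_comp _ _ _ _ _ _ (`[0, 1]%classic : set (measurableTypeR R))) => //.
  - by move=> _ [x + <-].
  - exact/measurable_EFinP.
  - exact: measurable_funTS.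
rewrite [RHS](ge0_negligible_integral (measurableC mD) _ _ _ PD0)//.
- rewrite setDE setCK setIidr// => w Dw /=; rewrite in_itv/=; exact: DX.
- exact: mXI.
- by move=> w /=; rewrite in_itv/= lee_fin; exact: g0.
Qed.

(** * Copulas *)

Local Notation square_space R := (measurableTypeR R * measurableTypeR R)%type.

Lemma copula_law_conull (R : realType) (C : copula R) :
  copula_law C (~` @unit_square R) = 0%E.
Proof.
have := probability_setC (copula_law C) (@measurable_unit_square R).
by rewrite copula_law_square subee.
Qed.

Lemma measurable_rectangle (R : realType) (a b c e : R) :
  measurable (`[a, b]%classic `*` `[c, e]%classic : set (square_space R)).
Proof. by apply: measurableX; exact: measurable_itv. Qed.

Lemma copula_ge0 (R : realType) (C : copula R) (u v : R) :
  0 <= u <= 1 -> 0 <= v <= 1 -> 0 <= C u v.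
Proof. by move=> u01 v01; rewrite -lee_fin -copula_cdf. Qed.

Lemma copula_mono (R : realType) (C : copula R) (u u' v v' : R) :
  0 <= u <= u' -> u' <= 1 -> 0 <= v <= v' -> v' <= 1 -> C u v <= C u' v'.
Proof.
move=> /andP[u0 uu] u1 /andP[v0 vv] v1.
have hu : 0 <= u <= 1 by rewrite u0 (le_trans uu).
have hv : 0 <= v <= 1 by rewrite v0 (le_trans vv).
have hu' : 0 <= u' <= 1 by rewrite u1 (le_trans u0).
have hv' : 0 <= v' <= 1 by rewrite v1 (le_trans v0).
rewrite -lee_fin -!copula_cdf//.
apply: le_measure; rewrite ?inE; try exact: measurable_rectangle.
move=> [x y] /=; rewrite !in_itv/= => -[/andP[-> xu] /andP[-> yv]].
by rewrite (le_trans xu uu) (le_trans yv vv).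
Qed.

(** Inclusion-exclusion: the rectangles with corners (u', v) and (u, v') lie in the one with corner
    (u', v') and meet in the one with corner (u, v). *)
Lemma copula_two_increasing (R : realType) (C : copula R) (u u' v v' : R) :
  0 <= u <= u' -> u' <= 1 -> 0 <= v <= v' -> v' <= 1 ->
  C u' v + C u v' <= C u' v' + C u v.
Proof.
move=> /andP[u0 uu] u1 /andP[v0 vv] v1.
have hu : 0 <= u <= 1 by rewrite u0 (le_trans uu).
have hv : 0 <= v <= 1 by rewrite v0 (le_trans vv).
have hu' : 0 <= u' <= 1 by rewrite u1 (le_trans u0).
have hv' : 0 <= v' <= 1 by rewrite v1 (le_trans v0).
pose A : set (square_space R) := `[0, u']%classic `*` `[0, v]%classic.
pose B : set (square_space R) := `[0, u]%classic `*` `[0, v']%classic.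
have AB : A `&` B = `[0, u]%classic `*` `[0, v]%classic.
  apply/seteqP; split=> -[x y] /=; rewrite /A/B/= !in_itv/=.
    by move=> [[/andP[-> _] /andP[-> ->]] [/andP[_ ->]]].
  move=> [/andP[-> xu] /andP[-> yv]].
  by rewrite xu yv (le_trans xu uu) (le_trans yv vv).
have ABs : A `|` B `<=` `[0, u']%classic `*` `[0, v']%classic.
  move=> [x y] /=; rewrite /A/B/= !in_itv/=.
  move=> [[/andP[-> ->] /andP[-> yv]]|[/andP[-> xu] /andP[-> ->]]].
    by rewrite (le_trans yv vv).
  by rewrite (le_trans xu uu).
have mAB : copula_law C (A `|` B) = (C u' v + C u v' - C u v)%:E.
  have cA : copula_law C A = (C u' v)%:E by exact: copula_cdf.
  have cB : copula_law C B = (C u v')%:E by exact: copula_cdf.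
  have mA : measurable A by exact: measurable_rectangle.
  have mB : measurable B by exact: measurable_rectangle.
  have Afin : (copula_law C A < +oo)%E by rewrite cA ltry.
  rewrite (measureUfinl mA mB Afin) AB.
  transitivity (copula_law C A + copula_law C B -
      copula_law C (`[0%R, u]%classic `*` `[0%R, v]%classic))%E => //.
  by rewrite cA cB copula_cdf.
rewrite -lerBlDr -lee_fin -mAB -copula_cdf//.
apply: le_measure => //; rewrite inE.
  by apply: measurableU; exact: measurable_rectangle.
exact: measurable_rectangle.
Qed.

Lemma copula_le1 (R : realType) (C : copula R) (u v : R) :
  0 <= u <= 1 -> 0 <= v <= 1 -> C u v <= u.
Proof.
move=> u01 /andP[v0 v1]; rewrite -[leRHS](copula_margin1 C u01).
by case/andP: (u01) => u0 u1; apply: copula_mono; rewrite ?u0 ?v0/=.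
Qed.

Lemma copula_le2 (R : realType) (C : copula R) (u v : R) :
  0 <= u <= 1 -> 0 <= v <= 1 -> C u v <= v.
Proof.
move=> /andP[u0 u1] v01; rewrite -[leRHS](copula_margin2 C v01).
by case/andP: (v01) => v0 v1; apply: copula_mono; rewrite ?u0 ?v0/=.
Qed.

Lemma copula_lipschitz1 (R : realType) (C : copula R) (u u' v : R) :
  0 <= u <= u' -> u' <= 1 -> 0 <= v <= 1 -> C u' v <= C u v + (u' - u).
Proof.
move=> uu u1 v01; have := @copula_two_increasing _ C u u' v 1 uu u1 v01 (lexx _).
case/andP: uu => u0 uu; rewrite !copula_margin1; first lra.
- by rewrite u1 (le_trans u0).
- by rewrite u0 (le_trans uu).
Qed.

Lemma copula_lipschitz2 (R : realType) (C : copula R) (u v v' : R) :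
  0 <= v <= v' -> v' <= 1 -> 0 <= u <= 1 -> C u v' <= C u v + (v' - v).
Proof.
move=> vv v1 u01; have := @copula_two_increasing _ C u 1 v v' u01 (lexx _) vv v1.
case/andP: vv => v0 vv; rewrite !copula_margin2; first lra.
- by rewrite v1 (le_trans v0).
- by rewrite v0 (le_trans vv).
Qed.

Lemma measurable_real_fst (R : realType) (D : set (square_space R)) :
  measurable_fun D (fun w : square_space R => w.1 : R).
Proof. by apply: measurable_funTS; exact: measurable_fst. Qed.

Lemma measurable_real_snd (R : realType) (D : set (square_space R)) :
  measurable_fun D (fun w : square_space R => w.2 : R).
Proof. by apply: measurable_funTS; exact: measurable_snd. Qed.

Lemma measurable_set_le d (T : measurableType d) (R : realType) (f g : T -> R) :
  measurable_fun setT f -> measurable_fun setT g ->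
  measurable [set x | f x <= g x].
Proof.
by move=> mf mg; rewrite -[X in measurable X]setTI; exact: measurable_fun_le.
Qed.

(** On the square, C w is the mass of the section at w of one fixed measurable set, that of the
    pairs (w, z) with 0 <= z <= w coordinatewise. Masses of sections depend measurably on the base
    point. *)
Lemma measurable_copula (R : realType) (C : copula R) :
  measurable_fun (@unit_square R : set (square_space R))
    (fun w : square_space R => C w.1 w.2).
Proof.
pose A : set (square_space R * square_space R) :=
  [set p | (0 : R) <= p.2.1] `&` [set p | (p.2.1 : R) <= p.1.1] `&`
  ([set p | (0 : R) <= p.2.2] `&` [set p | (p.2.2 : R) <= p.1.2]).
have m1 : measurable_fun setT (fun p : square_space R * square_space R => p.1.1 : R).
  exact: (measurableT_comp (@measurable_real_fst R setT) measurable_fst).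
have m2 : measurable_fun setT (fun p : square_space R * square_space R => p.1.2 : R).
  exact: (measurableT_comp (@measurable_real_snd R setT) measurable_fst).
have m3 : measurable_fun setT (fun p : square_space R * square_space R => p.2.1 : R).
  exact: (measurableT_comp (@measurable_real_fst R setT) measurable_snd).
have m4 : measurable_fun setT (fun p : square_space R * square_space R => p.2.2 : R).
  exact: (measurableT_comp (@measurable_real_snd R setT) measurable_snd).
have mA : measurable A.
  by apply: measurableI; apply: measurableI; exact: measurable_set_le.
apply: (@eq_measurable_fun _ _ _ _ _
    (fun w => fine (copula_law C (xsection A w)))).
  move=> w; rewrite inE => -[] /=; rewrite !in_itv/= => u01 v01.
  rewrite (_ : xsection A w = `[0, w.1]%classic `*` `[0, w.2]%classic).
    by rewrite copula_cdf.
  apply/seteqP; split=> z; rewrite /xsection/= inE/= !in_itv/=.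
    by move=> [[/= z10 z1u] [/= z20 z2v]]; rewrite z10 z1u z20 z2v.
  by move=> [/andP[z10 z1u] /andP[z20 z2v]].
apply: measurable_funTS; apply: measurableT_comp => //.
exact: measurable_fun_xsection.
Qed.

Lemma measurable_diagonal (R : realType) (C : copula R) :
  measurable_fun (`[0, 1]%classic : set R) (fun u => C u u).
Proof.
apply: (@measurable_comp _ _ _ (measurableTypeR R) (square_space R) _
  (@unit_square R) (fun w : square_space R => C w.1 w.2) _
  (fun u => (u, u))) => //.
- by move=> _ [u u01 <-]; split.
- exact: measurable_copula.
- by apply: measurable_funTS; exact: measurable_fun_pair.
Qed.

(** * Bounds on Kendall's tau *)

Lemma unit_square_integrable (R : realType) (C : copula R)
    (f : square_space R -> R) (K : R) :
  measurable_fun (@unit_square R : set (square_space R)) f ->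
  (forall w, unit_square w -> `|f w| <= K) ->
  (copula_law C).-integrable (@unit_square R) (EFin \o f).
Proof.
move=> mf fK; apply: (@bounded_integrable _ _ _ _ _ _ K) => //.
by have /= -> := copula_law_square C; rewrite ltry.
Qed.

Lemma copula_law_fst (R : realType) (C : copula R) (u : R) : 0 <= u <= 1 ->
  copula_law C ((fun w : square_space R => w.1 : measurableTypeR R)
    @^-1` `[0, u]%classic) = u%:E.
Proof.
move=> u01; have le11 : 0 <= (1 : R) <= 1 by rewrite ler01 lexx.
rewrite -(measure_setI_conull (@measurable_unit_square R) _ (copula_law_conull C)).
  rewrite -[in RHS](copula_margin1 C u01) -copula_cdf//.
  congr (copula_law C _); apply/seteqP; split=> w /=; rewrite /unit_square/= !in_itv/=.
    by move=> [/andP[-> ->] [_ ->]].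
  move=> [/andP[-> wu] ->]; case/andP: u01 => _ u1.
  by rewrite (le_trans wu u1) wu.
by rewrite -[X in measurable X]setTI; exact: measurable_fst.
Qed.

Lemma copula_law_snd (R : realType) (C : copula R) (v : R) : 0 <= v <= 1 ->
  copula_law C ((fun w : square_space R => w.2 : measurableTypeR R)
    @^-1` `[0, v]%classic) = v%:E.
Proof.
move=> v01; have le11 : 0 <= (1 : R) <= 1 by rewrite ler01 lexx.
rewrite -(measure_setI_conull (@measurable_unit_square R) _ (copula_law_conull C)).
  rewrite -[in RHS](copula_margin2 C v01) -copula_cdf//.
  congr (copula_law C _); apply/seteqP; split=> w /=; rewrite /unit_square/= !in_itv/=.
    by move=> [/andP[-> ->] [-> _]].
  move=> [-> /andP[-> wv]]; case/andP: v01 => _ v1.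
  by rewrite (le_trans wv v1) wv.
by rewrite -[X in measurable X]setTI; exact: measurable_snd.
Qed.

Lemma integral_fst (R : realType) (C : copula R) (g : R -> R) :
  measurable_fun (`[0, 1]%classic : set R) g ->
  (forall x, 0 <= x <= 1 -> 0 <= g x) ->
  \int[copula_law C]_(w in @unit_square R) g w.1 =
  \int[lebesgue_measure]_(x in `[0, 1]) g x.
Proof.
move=> mg g0; apply: (@integral_uniform_margin _ _ _ (copula_law C)
  (@unit_square R) (fun w : square_space R => w.1) g) => //.
- exact: copula_law_square.
- by move=> w [/=]; rewrite in_itv.
- exact: measurable_fst.
- exact: copula_law_fst.
Qed.

Lemma integral_snd (R : realType) (C : copula R) (g : R -> R) :
  measurable_fun (`[0, 1]%classic : set R) g ->
  (forall x, 0 <= x <= 1 -> 0 <= g x) ->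
  \int[copula_law C]_(w in @unit_square R) g w.2 =
  \int[lebesgue_measure]_(x in `[0, 1]) g x.
Proof.
move=> mg g0; apply: (@integral_uniform_margin _ _ _ (copula_law C)
  (@unit_square R) (fun w : square_space R => w.2) g) => //.
- exact: copula_law_square.
- by move=> w [_ /=]; rewrite in_itv.
- exact: measurable_snd.
- exact: copula_law_snd.
Qed.

Lemma integral_id01 (R : realType) :
  \int[lebesgue_measure]_(x in `[0, 1]) x = 1 / 2 :> R.
Proof.
transitivity (\int[lebesgue_measure]_(x in `[0, 1]) (1 * x + 0) : R).
  by apply: eq_Rintegral => x _; rewrite mul1r addr0.
by rewrite integral_affine//; field.
Qed.

(* Both sides are the measure of [{(w, t) | max w.1 w.2 <= t <= 1}]. *)
Lemma integral_oneB_max (R : realType) (C : copula R) :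
  \int[copula_law C]_(w in @unit_square R) (1 - Num.max w.1 w.2) =
  \int[lebesgue_measure]_(t in `[0, 1]) C t t.
Proof.
congr fine.
pose A : set (square_space R * measurableTypeR R) :=
  (@unit_square R `*` `[0, 1]%classic) `&`
  ([set p | (p.1.1 : R) <= p.2] `&` [set p | (p.1.2 : R) <= p.2]).
have mA : measurable A.
  apply: measurableI; first exact: measurableX.
  have m2 : measurable_fun setT (fun p : square_space R * measurableTypeR R => p.2 : R).
    exact: measurable_snd.
  apply: measurableI; apply: measurable_set_le => //.
    exact: (measurableT_comp (@measurable_real_fst R setT) measurable_fst).
  exact: (measurableT_comp (@measurable_real_snd R setT) measurable_fst).
have := @indic_fubini_tonelli _ _ _ _ R (copula_law C) lebesgue_measure A mA.
rewrite indic_fubini_tonelli_FE// indic_fubini_tonelli_GE//.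
move=> E.
transitivity (\int[copula_law C]_x (lebesgue_measure \o xsection A) x)%E.
  rewrite integral_mkcond; apply: eq_integral => w _ /=.
  rewrite patchE; case: ifPn => [|wD].
    rewrite inE => -[] /=; rewrite !in_itv/= => /andP[w10 w11] /andP[w20 w21].
    have -> : xsection A w = `[Num.max w.1 w.2, 1]%classic.
      apply/seteqP; split=> t; rewrite /xsection/= inE/= !in_itv/= ge_max.
        by move=> [[_ /andP[_ /= t1]] [/= w1t w2t]]; rewrite w1t w2t.
      move=> /andP[/andP[h1 h2] t1]; split => //=; split=> /=.
        by split; rewrite /= in_itv/= ?w10 ?w20.
      by rewrite in_itv/= t1 (le_trans w10 h1).
    by rewrite lebesgue_itvcc// ge_max w11.
  rewrite (_ : xsection A w = set0) ?measure0//.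
  apply/seteqP; split => // t; rewrite /xsection/= inE => -[[/= /mem_set]].
  by rewrite (negbTE wD).
rewrite E [RHS]integral_mkcond; apply: eq_integral => t _ /=.
rewrite patchE; case: ifPn => [|tD].
  rewrite inE/= in_itv/= => /andP[t0 t1].
  have -> : ysection A t = `[0, t]%classic `*` `[0, t]%classic.
    apply/seteqP; split=> w; rewrite /ysection/= inE/= !in_itv/=.
      move=> [[[/= ]]]; rewrite !in_itv/= => /andP[w10 _] /andP[w20 _] _ [/= w1t w2t].
      by rewrite w10 w20 w1t w2t.
    move=> [/andP[w10 w1t] /andP[w20 w2t]]; split=> //; split=> /=.
      by split; rewrite /= in_itv/= ?w10 ?w20 (le_trans _ t1).
    by rewrite in_itv/= t0.
  by rewrite copula_cdf// t0.
rewrite (_ : ysection A t = set0) ?measure0//.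
apply/seteqP; split => // w; rewrite /ysection/= inE => -[[/= _ tI]].
by move: tD; rewrite notin_setE; case.
Qed.

Lemma integrable_fst (R : realType) (C : copula R) :
  (copula_law C).-integrable (@unit_square R) (EFin \o fst).
Proof.
apply: (@unit_square_integrable _ _ _ 1).
  exact: measurable_real_fst.
by move=> w [/=]; rewrite in_itv/= => /andP[w0 w1] _; rewrite ger0_norm.
Qed.

Lemma integrable_snd (R : realType) (C : copula R) :
  (copula_law C).-integrable (@unit_square R) (EFin \o snd).
Proof.
apply: (@unit_square_integrable _ _ _ 1).
  exact: measurable_real_snd.
by move=> w [_ /=]; rewrite in_itv/= => /andP[w0 w1]; rewrite ger0_norm.
Qed.

Lemma measurable_real_min (R : realType) (D : set (square_space R)) :
  measurable_fun D (fun w : square_space R => Num.min (w.1 : R) w.2).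
Proof.
apply: measurable_minr.
  exact: measurable_real_fst.
exact: measurable_real_snd.
Qed.

Lemma integrable_min (R : realType) (C : copula R) :
  (copula_law C).-integrable (@unit_square R)
    (EFin \o (fun w : square_space R => Num.min (w.1 : R) w.2)).
Proof.
apply: (@unit_square_integrable _ _ _ 1).
  exact: measurable_real_min.
move=> w [/=]; rewrite !in_itv/= => /andP[w10 w11] /andP[w20 w21].
by rewrite ger0_norm ?le_min ?w10// ge_min w11.
Qed.

Lemma integrable_copula (R : realType) (C : copula R) :
  (copula_law C).-integrable (@unit_square R)
    (EFin \o (fun w : square_space R => C w.1 w.2)).
Proof.
apply: (@unit_square_integrable _ _ _ 1); first exact: measurable_copula.
move=> w [/=]; rewrite !in_itv/= => w1 w2.
rewrite ger0_norm ?copula_ge0// (le_trans (copula_le1 C w1 w2))//.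
by case/andP: w1.
Qed.

Lemma integral_fst_half (R : realType) (C : copula R) :
  \int[copula_law C]_(w in @unit_square R) w.1 = 1 / 2.
Proof.
rewrite -integral_id01; apply: (@integral_fst _ C id) => // x.
by case/andP.
Qed.

Lemma integral_snd_half (R : realType) (C : copula R) :
  \int[copula_law C]_(w in @unit_square R) w.2 = 1 / 2.
Proof.
rewrite -integral_id01; apply: (@integral_snd _ C id) => // x.
by case/andP.
Qed.

(** Writing min(u, v) = (1 - max(u, v)) + (u + v - 1) reduces this to [integral_oneB_max], because
    the uniform margins give u + v - 1 the mean 0. *)
Lemma integral_min (R : realType) (C : copula R) :
  \int[copula_law C]_(w in @unit_square R) Num.min w.1 w.2 =
  \int[lebesgue_measure]_(t in `[0, 1]) C t t.
Proof.
have iB : (copula_law C).-integrable (@unit_square R)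
    (EFin \o (fun w : square_space R => 1 - Num.max (w.1 : R) w.2)).
  apply: (@unit_square_integrable _ _ _ 1).
    apply: measurable_funB => //; apply: measurable_maxr.
      exact: measurable_real_fst.
    exact: measurable_real_snd.
  move=> w [/=]; rewrite !in_itv/= => /andP[w10 w11] /andP[w20 w21].
  by rewrite ger0_norm ?subr_ge0 ?ge_max ?w11// gerBl le_max w10.
have i1 := integrable_fst C; have i2 := integrable_snd C.
have iD : (copula_law C).-integrable (@unit_square R)
    (EFin \o (fun w : square_space R => (w.1 : R) + w.2)).
  exact: (integrableD _ i1 i2).
have ic : (copula_law C).-integrable (@unit_square R)
    (EFin \o (fun w : square_space R => (1 : R))).
  apply: (@unit_square_integrable _ _ _ 1) => //.
  by move=> w _; rewrite normr1.
have iDB : (copula_law C).-integrable (@unit_square R)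
    (EFin \o (fun w : square_space R => (w.1 : R) + w.2 - 1)).
  exact: (integrableB _ iD ic).
rewrite -integral_oneB_max.
transitivity (\int[copula_law C]_(w in @unit_square R)
    ((1 - Num.max (w.1 : R) w.2) + ((w.1 : R) + w.2 - 1))).
  by apply: eq_Rintegral => w _; rewrite maxEle minEle; case: ifP => _; ring.
rewrite (RintegralD _ iB iDB)// (RintegralB _ iD ic)// (RintegralD _ i1 i2)//.
rewrite integral_fst_half integral_snd_half.
rewrite Rintegral_cst//; have -> : fine (copula_law C (@unit_square R)) = 1.
  by rewrite copula_law_square.
by field.
Qed.

Lemma integral_copula_le (R : realType) (C : copula R) :
  \int[copula_law C]_(w in @unit_square R) C w.1 w.2 <=
  \int[lebesgue_measure]_(t in `[0, 1]) C t t.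
Proof.
rewrite -integral_min; apply: le_Rintegral => //.
- exact: integrable_copula.
- exact: integrable_min.
- move=> w [/=]; rewrite !in_itv/= => w1 w2.
  by rewrite le_min copula_le1// copula_le2.
Qed.

Lemma measurable_diagonal_fst (R : realType) (C : copula R) :
  measurable_fun (@unit_square R : set (square_space R))
    (fun w : square_space R => C w.1 w.1).
Proof.
apply: (@measurable_comp _ _ _ (square_space R) (measurableTypeR R) _
  (`[0, 1]%classic : set R) (fun u => C u u) _ fst) => //.
- by move=> _ [w [w1 _] <-].
- exact: measurable_diagonal.
- exact: measurable_real_fst.
Qed.

(** This is C(u, u) - (u - v)^+. The positive part is written as u - min(u, v) so that
    [integral_min] applies to it. *)
Definition diagonal_bound {R : realType} (C : copula R) (w : square_space R) : R :=
  C w.1 w.1 - (w.1 - Num.min (w.1 : R) w.2).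

Lemma measurable_diagonal_bound (R : realType) (C : copula R) :
  measurable_fun (@unit_square R : set (square_space R)) (diagonal_bound C).
Proof.
apply: measurable_funB; first exact: measurable_diagonal_fst.
apply: measurable_funB; first exact: measurable_real_fst.
exact: measurable_real_min.
Qed.

Lemma integrable_diagonal_fst (R : realType) (C : copula R) :
  (copula_law C).-integrable (@unit_square R)
    (EFin \o (fun w : square_space R => C w.1 w.1)).
Proof.
apply: (@unit_square_integrable _ _ _ 1); first exact: measurable_diagonal_fst.
move=> w [/=]; rewrite !in_itv/= => w1 w2.
rewrite ger0_norm ?copula_ge0// (le_trans (copula_le1 C w1 w1))//.
by case/andP: w1.
Qed.

Lemma integrable_diagonal_bound (R : realType) (C : copula R) :
  (copula_law C).-integrable (@unit_square R) (EFin \o diagonal_bound C).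
Proof.
have mS := @measurable_unit_square R.
have iB := integrableB mS (integrable_fst C) (integrable_min C).
exact: (integrableB mS (integrable_diagonal_fst C) iB).
Qed.

(** The integral of the diagonal section enters twice, once through the first margin and once as E
    min(U, V). *)
Lemma integral_diagonal_bound (R : realType) (C : copula R) :
  \int[copula_law C]_(w in @unit_square R) diagonal_bound C w =
  2 * \int[lebesgue_measure]_(t in `[0, 1]) C t t - 1 / 2.
Proof.
have i1 := integrable_fst C; have im := integrable_min C.
have id := integrable_diagonal_fst C.
have iB : (copula_law C).-integrable (@unit_square R)
    (EFin \o (fun w : square_space R => (w.1 : R) - Num.min (w.1 : R) w.2)).
  exact: (integrableB _ i1 im).
rewrite RintegralB// RintegralB// integral_fst_half integral_min.
rewrite (@integral_fst _ C (fun u => C u u)); first by field.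
  exact: measurable_diagonal.
by move=> u u01; exact: copula_ge0.
Qed.

Lemma diagonal_bound_le (R : realType) (C : copula R) (u v : R) :
  0 <= u <= 1 -> 0 <= v <= 1 -> diagonal_bound C (u, v) <= C u v.
Proof.
move=> u01 v01; rewrite /diagonal_bound/=.
case/andP: (u01) => u0 u1; case/andP: (v01) => v0 v1.
have [uv|vu] := leP u v.
  by rewrite subrr subr0; apply: copula_mono; rewrite ?u0 ?u1 ?lexx.
have := @copula_lipschitz2 _ C u v u _ u1 u01.
by rewrite v0 ltW// => /(_ isT); lra.
Qed.

Lemma integral_copula_ge (R : realType) (C : copula R) :
  2 * \int[lebesgue_measure]_(t in `[0, 1]) C t t - 1 / 2 <=
  \int[copula_law C]_(w in @unit_square R) C w.1 w.2.
Proof.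
rewrite -integral_diagonal_bound; apply: le_Rintegral => //.
- exact: integrable_diagonal_bound.
- exact: integrable_copula.
- by move=> w [/=]; rewrite !in_itv/= => w1 w2; apply: diagonal_bound_le.
Qed.

(** Let I be the integral of the diagonal section and J that of C against its law. J <= I and J >=
    2I - 1/2 turn into lines of slopes 2/3 and 4/3 in p through (1, 1). The mean of the slopes is 1,
    whence the symmetry about t = p. *)
Lemma kendall_tau_footrule_bounds (R : realType) (C : copula R) :
  let p := spearman_footrule C in
  p - (1 - p) / 3 <= kendall_tau C <= p + (1 - p) / 3.
Proof.
have := integral_copula_le C; have := integral_copula_ge C.
by rewrite /= /kendall_tau /spearman_footrule => h1 h2; apply/andP; split; lra.
Qed.

(** * Bounds on the diagonal section *)

Lemma integrable_diagonal (R : realType) (C : copula R) :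
  lebesgue_measure.-integrable `[0, 1] (EFin \o (fun u => C u u)).
Proof.
apply: (@bounded_integrable _ _ _ _ _ _ 1) => //; first exact: lebesgue01_lty.
  exact: measurable_diagonal.
move=> u /=; rewrite in_itv/= => u01.
rewrite ger0_norm ?copula_ge0// (le_trans (copula_le1 C u01 u01))//.
by case/andP: u01.
Qed.

Lemma diagonal_lipschitz (R : realType) (C : copula R) (u u' : R) :
  0 <= u <= u' -> u' <= 1 -> C u' u' <= C u u + 2 * (u' - u).
Proof.
move=> uu u1; case/andP: (uu) => u0 uu'.
have u'01 : 0 <= u' <= 1 by rewrite u1 (le_trans u0).
have u01 : 0 <= u <= 1 by rewrite u0 (le_trans uu').
have := copula_lipschitz1 C uu u1 u'01.
have := copula_lipschitz2 C uu u1 u01.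
lra.
Qed.

(** With d = C(1/2, 1/2), the list [l] encodes the largest diagonal compatible with d: the identity
    up to d, the constant d up to 1/2, slope 2 until the identity is met at 1 - d, then the
    identity. The missing triangle has base 1 - 2d and height 1/2 - d. *)
Lemma integral_diagonal_le (R : realType) (C : copula R) :
  \int[lebesgue_measure]_(t in `[0, 1]) C t t <= 1 / 2 - (1 / 2 - C (1 / 2) (1 / 2)) ^+ 2.
Proof.
set d := C (1 / 2) (1 / 2); have h01 : 0 <= (1 / 2 : R) <= 1 by lra.
have d0 : 0 <= d by exact: copula_ge0.
have dh : d <= 1 / 2 by exact: copula_le1.
pose l : seq (R * R * R) :=
  [:: (0, 1, 0); (d, -1, d); (1 / 2, 2, -1); (1 - d, -1, 1 - d)].
have := @integral_step_affine _ l.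
have -> : all (fun h : R * R * R => 0 <= h.1.1 <= 1) l.
  by rewrite /l/= !andbT; apply/and4P; split; lra.
move=> /(_ isT) lE; apply: (@le_trans _ _
    (\int[lebesgue_measure]_(t in `[0, 1]) step_affine l t)).
  apply: le_Rintegral => //; first exact: integrable_diagonal.
    exact: integrable_step_affine.
  move=> u /=; rewrite in_itv/= => u01; case/andP: (u01) => u0 u1.
  have cu := copula_le1 C u01 u01.
  rewrite /step_affine /l !big_cons big_nil /= u0.
  have [u2|u2] := leP (1 / 2) u.
    have := @diagonal_lipschitz _ C (1 / 2) u; rewrite u2 andbT.
    case/andP: h01 => -> _ => /(_ isT u1); rewrite -/d => cl.
    by have [?|?] := leP d u; have [?|?] := leP (1 - d) u; lra.
  have := @copula_mono _ C u (1 / 2) u (1 / 2); rewrite u0 (ltW u2).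
  case/andP: h01 => _ -> => /(_ isT isT isT isT); rewrite -/d => cl.
  by have [?|?] := leP d u; have [?|?] := leP (1 - d) u; lra.
by rewrite lE /l !big_cons big_nil /=; lra.
Qed.

(** Dually, the smallest diagonal is 0 up to (1 - d)/2, rises with slope 2 to d at 1/2, stays at d
    until (1 + d)/2, and then equals 2u - 1. *)
Lemma integral_diagonal_ge (R : realType) (C : copula R) :
  1 / 4 + C (1 / 2) (1 / 2) ^+ 2 / 2 <= \int[lebesgue_measure]_(t in `[0, 1]) C t t.
Proof.
set d := C (1 / 2) (1 / 2); have h01 : 0 <= (1 / 2 : R) <= 1 by lra.
have d0 : 0 <= d by exact: copula_ge0.
have dh : d <= 1 / 2 by exact: copula_le1.
pose l : seq (R * R * R) :=
  [:: ((1 - d) / 2, 2, d - 1); (1 / 2, -2, 1); ((1 + d) / 2, 2, -1 - d)].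
have := @integral_step_affine _ l.
have -> : all (fun h : R * R * R => 0 <= h.1.1 <= 1) l.
  by rewrite /l/= !andbT; apply/and3P; split; lra.
move=> /(_ isT) lE; apply: (@le_trans _ _
    (\int[lebesgue_measure]_(t in `[0, 1]) step_affine l t)); last first.
  apply: le_Rintegral => //; last 2 first.
  - exact: integrable_diagonal.
  - move=> u /=; rewrite in_itv/= => u01; case/andP: (u01) => u0 u1.
    have cu := copula_ge0 C u01 u01.
    have := @diagonal_lipschitz _ C u 1; rewrite u0 u1 => /(_ isT (lexx _)).
    rewrite copula_margin1 ?ler01 ?lexx// => cl1.
    rewrite /step_affine /l !big_cons big_nil /=.
    have [u2|u2] := leP (1 / 2) u.
      have := @copula_mono _ C (1 / 2) u (1 / 2) u; rewrite u2 andbT u1.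
      case/andP: h01 => -> _ => /(_ isT isT isT isT); rewrite -/d => cl.
      by have [?|?] := leP ((1 - d) / 2) u; have [?|?] := leP ((1 + d) / 2) u; lra.
    have := @diagonal_lipschitz _ C u (1 / 2); rewrite u0 (ltW u2).
    case/andP: h01 => _ -> => /(_ isT isT); rewrite -/d => cl.
    by have [?|?] := leP ((1 - d) / 2) u; have [?|?] := leP ((1 + d) / 2) u; lra.
  exact: integrable_step_affine.
by rewrite lE /l !big_cons big_nil /=; lra.
Qed.

(** Substituting d = (1 + b)/4 turns the two diagonal bounds into the constants 3/8 and 3/16. *)
Lemma copula_admissible (R : realType) (C : copula R) :
  admissible (spearman_footrule C) (blomqvist_beta C).
Proof.
have h01 : 0 <= (1 / 2 : R) <= 1 by lra.
have := integral_diagonal_le C; have := integral_diagonal_ge C.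
have := copula_ge0 C h01 h01; have := copula_le1 C h01 h01.
rewrite /admissible /spearman_footrule /blomqvist_beta.
set d := C (1 / 2) (1 / 2); set I := Rintegral _ _ _ => d1 d0 h1 h2.
by split; apply/andP; split; lra.
Qed.

(** * Piecewise isometric involutions *)

(* [h.1] tells whether the isometry reverses orientation. *)
Definition isometry {R : realType} (h : bool * R) (x : R) : R :=
  if h.1 then h.2 - x else x + h.2.

Lemma measurable_isometry (R : realType) (h : bool * R) :
  measurable_fun setT (isometry h : measurableTypeR R -> measurableTypeR R).
Proof.
rewrite /isometry; case: h => [[|] c] /=.
  exact: measurable_funB.
exact: measurable_funD.
Qed.

Lemma lebesgue_isometry (R : realType) (h : bool * R) (A : set R) :
  measurable A -> lebesgue_measure (isometry h @^-1` A) = lebesgue_measure A.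
Proof.
move=> mA; have tr (c : R) (B : set R) : measurable B ->
    lebesgue_measure ((fun x : R => x + c) @^-1` B) = lebesgue_measure B.
  move=> mB; have mt : measurable_fun setT
      ((fun x => x + c) : measurableTypeR R -> measurableTypeR R).
    exact: measurable_funD.
  pose f' := isMeasurableFun.Build _ _ _ _ _ mt.
  pose f : {mfun measurableTypeR R >-> measurableTypeR R} :=
    HB.pack ((fun x => x + c) : measurableTypeR R -> measurableTypeR R) f'.
  apply: esym.
  apply: (lebesgue_measure_unique
    (mu := pushforward lebesgue_measure f)) => // _ [[a b] _ <-].
  transitivity (lebesgue_measure (`]a - c, b - c]%classic : set R)).
    by rewrite !lebesgue_measure_itv/= !lte_fin ltrD2r -!EFinB; congr (if _ then _%:E else _); ring.
  congr lebesgue_measure.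
  by apply/seteqP; split => x; rewrite /= !in_itv/= ltrBlDr lerBrDr.
case: h => [[|] c]; last exact: tr.
rewrite -(tr c A mA) -(lebesgue_measureN (A := (fun x : R => x + c) @^-1` A)).
  by congr lebesgue_measure; apply/seteqP; split => x /=; rewrite addrC.
rewrite -[X in measurable X]setTI.
by apply: (@measurable_isometry _ (false, c)).
Qed.

Section piecewise_isometry.
Context (R : realType) (n : nat) (piece : R -> nat) (tab : nat -> bool * R)
  (s : nat -> nat).

Definition piecewise_isometry (x : R) : R := isometry (tab (piece x)) x.

(** Finite data that force an involution preserving Lebesgue measure: [s] is an involution of the
    labels, and the isometry of label [s i] inverts that of [i]. A cell is any level set of [piece],
    possibly a union of distant intervals, so one label can serve several blocks. *)
Record reversible_pieces := ReversiblePieces {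
  piece_lt : forall x, (piece x < n)%N;
  measurable_piece : measurable_fun setT piece;
  piece_swapK : forall i, (i < n)%N -> s (s i) = i;
  piece_swap_lt : forall i, (i < n)%N -> (s i < n)%N;
  isometry_swapK : forall i x, (i < n)%N ->
    isometry (tab (s i)) (isometry (tab i) x) = x;
  piece_swap : forall x, piece (piecewise_isometry x) = s (piece x) }.

Context (H : reversible_pieces).

Let T := piecewise_isometry.

Lemma piecewise_isometryK x : T (T x) = x.
Proof.
rewrite {1}/T /piecewise_isometry (piece_swap H) isometry_swapK//.
exact: piece_lt.
Qed.

Let A (i : nat) := [set x | piece x = i].

Let mA i : measurable (A i).
Proof.
by have := measurable_piece H measurableT (Y := [set i]); rewrite setTI; apply.
Qed.

Let A_swap i x : (i < n)%N -> A (s i) (isometry (tab i) x) <-> A i x.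
Proof.
move=> ni; split; rewrite /A/= => Ax.
  have := piece_swap H (isometry (tab i) x).
  by rewrite /piecewise_isometry Ax isometry_swapK// piece_swapK.
by rewrite -Ax -(piece_swap H).
Qed.

Let split_measure (B : set R) : measurable B ->
  lebesgue_measure B = (\sum_(i < n) lebesgue_measure (B `&` A i))%E.
Proof.
move=> mB.
have BE : B = \big[setU/set0]_(i < n) (B `&` A i).
  rewrite -(bigcup_mkord n (fun i => B `&` A i)); apply/seteqP; split => [x Bx|x [i _ []]//].
  by exists (piece x) => //=; exact: piece_lt.
rewrite [in LHS]BE (@measure_semi_additive_ord_I _ _ _ lebesgue_measure (fun i => B `&` A i))//.
- by move=> k _; apply: measurableI => //; exact: mA.
- by move=> i j _ _ [x [[_ <-] [_ <-]]].
- by apply: bigsetU_measurable => i _; apply: measurableI => //; exact: mA.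
Qed.

Lemma measurable_piecewise_isometry :
  measurable_fun setT (T : measurableTypeR R -> measurableTypeR R).
Proof.
rewrite /T /piecewise_isometry /isometry.
have m1 : measurable_fun setT (fun x : measurableTypeR R => (tab (piece x)).1).
  exact: (measurableT_comp (f := fun i => (tab i).1) _ (measurable_piece H)).
have m2 : measurable_fun setT (fun x : measurableTypeR R => (tab (piece x)).2).
  exact: (measurableT_comp (f := fun i => (tab i).2) _ (measurable_piece H)).
apply: measurable_fun_ifT => //; first exact: measurable_funB.
exact: measurable_funD.
Qed.

(** Within cell [i], the preimage of [B] is the isometric preimage of the part of [B] in cell [s i].
    Summing over the cells and reindexing by [s] gives the claim. *)
Lemma lebesgue_piecewise_isometry (B : set R) : measurable B ->
  lebesgue_measure (T @^-1` B) = lebesgue_measure B.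
Proof.
move=> mB; have mT := measurable_piecewise_isometry.
have mTB : measurable (T @^-1` B).
  by rewrite -[X in measurable X]setTI; exact: mT.
rewrite split_measure// [RHS]split_measure//.
pose sw (i : 'I_n) : 'I_n := Ordinal (piece_swap_lt H (ltn_ord i)).
have swK : involutive sw by move=> i; apply/val_inj => /=; rewrite piece_swapK.
rewrite [RHS](reindex_inj (inv_inj swK))/=; apply: eq_bigr => i _.
rewrite -[RHS](lebesgue_isometry (tab i)); last by apply: measurableI => //; exact: mA.
congr lebesgue_measure; apply/seteqP; split => x /= [BTx Ax].
  split; last exact: (A_swap x (ltn_ord i)).2.
  by move: BTx; rewrite /T /piecewise_isometry; move: Ax; rewrite /A/= => ->.
have Ax' : A i x := (A_swap x (ltn_ord i)).1 Ax.
by split => //; move: Ax'; rewrite /A/= /T /piecewise_isometry => ->.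
Qed.

End piecewise_isometry.

(** * Copulas carried by a graph *)

Lemma copula_of_law (R : realType) (P : probability (square_space R) R) :
  P (@unit_square R) = 1%E ->
  (forall u : R, 0 <= u <= 1 -> P (`[0, u]%classic `*` `[0, 1]%classic) = u%:E) ->
  (forall v : R, 0 <= v <= 1 -> P (`[0, 1]%classic `*` `[0, v]%classic) = v%:E) ->
  exists C : copula R, copula_law C = P.
Proof.
move=> PS P1 P2.
have cdfP (u v : R) : 0 <= u <= 1 -> 0 <= v <= 1 ->
    P (`[0, u]%classic `*` `[0, v]%classic) =
    (fine (P (`[0, u]%classic `*` `[0, v]%classic)))%:E.
  by move=> _ _; rewrite fineK// fin_num_measure//; exact: measurable_rectangle.
have m1 (u : R) : 0 <= u <= 1 ->
    fine (P (`[0, u]%classic `*` `[0, 1]%classic)) = u.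
  by move=> u01; rewrite P1.
have m2 (v : R) : 0 <= v <= 1 ->
    fine (P (`[0, 1]%classic `*` `[0, v]%classic)) = v.
  by move=> v01; rewrite P2.
by exists (@Copula R
  (fun u v => fine (P (`[0, u]%classic `*` `[0, v]%classic))) P PS cdfP m1 m2).
Qed.

Definition graph_of {R : realType} (T : R -> R) (x : measurableTypeR R) :
  square_space R := (x, T x).

(** Stated for all measurable sets and not just rectangles, since the law is evaluated on the graph
    itself and on unions of rectangles. *)
Definition is_graph_copula {R : realType} (T : R -> R) (C : copula R) : Prop :=
  forall A : set (square_space R), measurable A ->
  copula_law C A = lebesgue_measure (graph_of T @^-1` A `&` `[0, 1]%classic).

(** The law is the image of the uniform law under x |-> (x, T x). The first margin is uniform by
    construction, the second because T preserves length; being an involution, T also preserves the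
    complement of [0, 1]. *)
Lemma graph_copula (R : realType) (T : R -> R) :
  measurable_fun setT (T : measurableTypeR R -> measurableTypeR R) ->
  (forall x, 0 <= x <= 1 -> 0 <= T x <= 1) ->
  (forall x, T (T x) = x) ->
  (forall B : set R, measurable B ->
    lebesgue_measure (T @^-1` B) = lebesgue_measure B) ->
  exists C : copula R, is_graph_copula T C.
Proof.
move=> mT T01 TK mp.
have mG : measurable_fun setT (graph_of T) by exact: measurable_fun_pair.
have mGI (A : set (square_space R)) : measurable A -> measurable (graph_of T @^-1` A).
  by move=> mA; rewrite -[X in measurable X]setTI; exact: mG.
pose mG' := isMeasurableFun.Build _ _ _ _ _ mG.
pose G : {mfun measurableTypeR R >-> square_space R} := HB.pack (graph_of T) mG'.
pose P : probability (square_space R) R := distribution (uniform_prob (@ltr01 R)) G.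
have PE (A : set (square_space R)) : measurable A ->
    P A = lebesgue_measure (graph_of T @^-1` A `&` `[0, 1]%classic).
  by move=> mA; rewrite -uniform_prob01E//; exact: mGI.
have T01' x : (0 <= T x <= 1) = (0 <= x <= 1).
  by apply/idP/idP => [/T01|/T01//]; rewrite TK.
have [|u u01|v v01|C CE] := @copula_of_law _ P.
- rewrite PE// (_ : _ `&` _ = `[0, 1]%classic); last first.
    apply/seteqP; split => x /=; first by case.
    by move=> x01; split => //; split; rewrite /= ?in_itv/= ?T01'.
  by rewrite lebesgue_itvcc// subr0.
- rewrite PE; last exact: measurable_rectangle.
  rewrite (_ : _ `&` _ = `[0, u]%classic); last first.
    case/andP: u01 => u0 u1; apply/seteqP; split => x /=; rewrite !in_itv/=.
      by case=> -[/=].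
    move=> /andP[x0 xu]; have x01 : 0 <= x <= 1 by rewrite x0 (le_trans xu).
    split; last by rewrite x01.
    by split; rewrite ?T01'// x0.
  by case/andP: u01 => u0 u1; rewrite lebesgue_itvcc// subr0.
- rewrite PE; last exact: measurable_rectangle.
  rewrite (_ : _ `&` _ = T @^-1` `[0, v]%classic); last first.
    case/andP: v01 => v0 v1; apply/seteqP; split => x /=; rewrite !in_itv/=.
      by case=> -[/=].
    move=> /andP[x0 xu]; have x01 : 0 <= x <= 1.
      by rewrite -T01' x0 (le_trans xu).
    split; last by rewrite x01.
    by split; rewrite ?x01// x0.
  by case/andP: v01 => v0 v1; rewrite mp// lebesgue_itvcc// subr0.
- by exists C => A mA; rewrite CE PE.
Qed.

(* The exceptional point [z] costs nothing because the margins are diffuse. *)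
Lemma graph_copula_law_le (R : realType) (T : R -> R) (C : copula R)
    (A B : set (square_space R)) (z : R) :
  measurable_fun setT (T : measurableTypeR R -> measurableTypeR R) ->
  is_graph_copula T C -> measurable A -> measurable B ->
  (forall y, 0 <= y <= 1 -> y != z -> A (y, T y) -> B (y, T y)) ->
  (copula_law C A <= copula_law C B)%E.
Proof.
move=> mT CT mA mB AB.
have mG : measurable_fun setT (graph_of T) by exact: measurable_fun_pair.
have mGI (D : set (square_space R)) : measurable D ->
    measurable (graph_of T @^-1` D `&` `[0, 1]%classic).
  move=> mD; apply: measurableI => //.
  by rewrite -[X in measurable X]setTI; exact: mG.
rewrite !CT// -[leRHS](@measureU0 _ _ _ lebesgue_measure _ [set z])//.
- apply: le_measure; rewrite ?inE.
  + exact: mGI.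
  + by apply: measurableU => //; exact: mGI.
  move=> y [/= Ay yI]; have [->|yz] := eqVneq y z; first by right.
  by left; split => //; apply: AB => //; move: yI; rewrite in_itv.
- exact: mGI.
- exact: lebesgue_measure_set1.
Qed.

Lemma graph_copula_full (R : realType) (T : R -> R) (C : copula R) :
  measurable_fun setT (T : measurableTypeR R -> measurableTypeR R) ->
  is_graph_copula T C ->
  measurable [set w : square_space R | w.2 = T w.1] /\
  copula_law C [set w : square_space R | w.2 = T w.1] = 1%E.
Proof.
move=> mT CT.
have mS : measurable [set w : square_space R | w.2 = T w.1].
  rewrite (_ : [set w : square_space R | _] =
    (fun w : square_space R => (w.2 : R) == T w.1) @^-1` [set true]).
    rewrite -[X in measurable X]setTI.
    have : measurable_fun setT (fun w : square_space R => (w.2 : R) == T w.1).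
      apply: measurable_fun_eqr; first exact: measurable_real_snd.
      exact: (measurableT_comp (f := T) mT measurable_fst).
    by apply.
  by apply/seteqP; split => w /= /eqP.
split => //; rewrite CT// (_ : _ `&` _ = `[0, 1]%classic).
  by rewrite lebesgue_itvcc// subr0.
by apply/seteqP; split => x /=; [case|].
Qed.

Lemma integral_graph (R : realType) (T : R -> R) (C : copula R) :
  measurable_fun setT (T : measurableTypeR R -> measurableTypeR R) ->
  (forall x, 0 <= x <= 1 -> 0 <= T x <= 1) -> is_graph_copula T C ->
  \int[lebesgue_measure]_(t in `[0, 1]) C t t =
  \int[lebesgue_measure]_(x in `[0, 1]) Num.min x (T x).
Proof.
move=> mT T01 CT; have [mS S1] := graph_copula_full mT CT.
have mg : measurable_fun (`[0, 1]%classic : set R) (fun x => Num.min x (T x)).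
  by apply: measurable_minr => //; exact: measurable_funTS.
rewrite -integral_min -(@integral_fst _ C (fun x => Num.min x (T x)))//.
  apply: (eq_Rintegral_full mS) => //.
  - exact: measurable_real_min.
  - apply: measurable_minr; first exact: measurable_real_fst.
    apply: measurable_funTS; exact: (measurableT_comp (f := T) mT measurable_fst).
  - by move=> w _ /= ->.
by move=> x x01; have /andP[Tx0 _] := T01 x x01; rewrite le_min Tx0; case/andP: x01 => ->.
Qed.

(* The last hypothesis says that C = min on the graph of T. *)
Lemma graph_copula_upper (R : realType) (T : R -> R) (C : copula R) :
  measurable_fun setT (T : measurableTypeR R -> measurableTypeR R) ->
  (forall x, 0 <= x <= 1 -> 0 <= T x <= 1) -> (forall x, T (T x) = x) ->
  is_graph_copula T C ->
  (forall x y, x <= T x -> y <= x -> T y <= T x) ->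
  let p := spearman_footrule C in kendall_tau C = p + (1 - p) / 3.
Proof.
move=> mT T01 TK CT HU; have [mS S1] := graph_copula_full mT CT.
suff : \int[copula_law C]_(w in @unit_square R) C w.1 w.2 =
       \int[lebesgue_measure]_(t in `[0, 1]) C t t.
  by rewrite /= /kendall_tau /spearman_footrule => ->; field.
rewrite -integral_min; apply: (eq_Rintegral_full mS) => //.
- exact: measurable_copula.
- exact: measurable_real_min.
move=> [x v] [/=]; rewrite !in_itv/= => x01 v01 vE.
have le11 : 0 <= (1 : R) <= 1 by rewrite ler01 lexx.
apply/eqP; rewrite eq_le le_min copula_le1// copula_le2//=.
have [xv|vx] := leP x v.
  rewrite -[leLHS](copula_margin1 C x01) -lee_fin -!copula_cdf//.
  (* The point 2 lies outside [0, 1], so this choice makes no exception at all. *)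
  apply: (@graph_copula_law_le _ T C _ _ 2) => //; try exact: measurable_rectangle.
  move=> y y01 _ [/=]; rewrite !in_itv/= => /andP[y0 yx] _; split; rewrite /= ?in_itv/=.
    by rewrite y0.
  by have /andP[-> _] := T01 y y01; rewrite vE; apply: HU => //; rewrite -vE.
rewrite -[leLHS](copula_margin2 C v01) -lee_fin -!copula_cdf//.
apply: (@graph_copula_law_le _ T C _ _ 2) => //; try exact: measurable_rectangle.
move=> y y01 _ [/=]; rewrite !in_itv/= => _ /andP[Ty0 Tyv]; split; rewrite /= ?in_itv/=.
  (* Since T is an involution, the case T x < x is the previous one with T x and T y in place of x
     and y. *)
  case/andP: (y01) => -> _ /=; rewrite -(TK y) -(TK x); apply: HU.
    by rewrite TK -vE ltW.
  by rewrite -vE.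
by rewrite Ty0.
Qed.

(* The last two hypotheses say that [C = diagonal_bound C] almost everywhere on
   the graph of T. *)
Lemma graph_copula_lower (R : realType) (T : R -> R) (C : copula R) :
  measurable_fun setT (T : measurableTypeR R -> measurableTypeR R) ->
  (forall x, 0 <= x <= 1 -> 0 <= T x <= 1) -> (forall x, T (T x) = x) ->
  is_graph_copula T C ->
  (forall x y, x <= T x -> y < x -> T y <= T x -> T y <= x) ->
  (forall x z, T x < z -> z <= x -> T z <= x) ->
  let p := spearman_footrule C in kendall_tau C = p - (1 - p) / 3.
Proof.
move=> mT T01 TK CT HL1 HL2; have [mS S1] := graph_copula_full mT CT.
suff : \int[copula_law C]_(w in @unit_square R) C w.1 w.2 =
       2 * \int[lebesgue_measure]_(t in `[0, 1]) C t t - 1 / 2.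
  by rewrite /= /kendall_tau /spearman_footrule => ->; field.
rewrite -integral_diagonal_bound; apply: (eq_Rintegral_full mS) => //.
- exact: measurable_copula.
- exact: measurable_diagonal_bound.
move=> [x v] [/=]; rewrite !in_itv/= => x01 v01 vE.
have le11 : 0 <= (1 : R) <= 1 by rewrite ler01 lexx.
apply/eqP; rewrite eq_le diagonal_bound_le// andbT /diagonal_bound/=.
have [xv|vx] := leP x v.
  rewrite subrr subr0 -lee_fin -!copula_cdf//.
  (* [HL1] needs y < x strictly, so the point x itself is the exception. *)
  apply: (@graph_copula_law_le _ T C _ _ x) => //; try exact: measurable_rectangle.
  move=> y y01 yx [/=]; rewrite !in_itv/= => /andP[y0 yxl] /andP[Ty0 Tyv].
  split; rewrite /= ?in_itv/=; first by rewrite y0.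
  by rewrite Ty0; apply: HL1; rewrite -?vE// lt_neqAle yx.
(* For v < x the goal C(x, v) <= C(x, x) - (x - v) says that [A] and [B] together have mass at least
   x. This is the mass of the strip of height x, and [HL2] places the part of the graph inside that
   strip in [A] or [B]. *)
pose A : set (square_space R) := `[0, x]%classic `*` `[0, x]%classic.
pose B : set (square_space R) := `[0, 1]%classic `*` `[0, v]%classic.
have mA : measurable A by exact: measurable_rectangle.
have mB : measurable B by exact: measurable_rectangle.
have cA : copula_law C A = (C x x)%:E by exact: copula_cdf.
have cB : copula_law C B = v%:E.
  by rewrite -[in RHS](copula_margin2 C v01); exact: copula_cdf.
have AB : A `&` B = `[0, x]%classic `*` `[0, v]%classic.
  case/andP: x01 => x0 x1; apply/seteqP; split=> -[y z] /=; rewrite /A/B/= !in_itv/=.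
    by move=> [[/andP[y0 yx] /andP[z0 zx]] [_ /andP[_ zv]]]; rewrite y0 yx z0 zv.
  move=> [/andP[y0 yx] /andP[z0 zv]].
  by rewrite y0 yx z0 zv (le_trans yx x1) (le_trans zv (ltW vx)).
have cAB : copula_law C (A `|` B) = (C x x + v - C x v)%:E.
  have Afin : (copula_law C A < +oo)%E by rewrite cA ltry.
  rewrite (measureUfinl mA mB Afin) AB.
  transitivity (copula_law C A + copula_law C B -
      copula_law C (`[0%R, x]%classic `*` `[0%R, v]%classic))%E => //.
  by rewrite cA cB copula_cdf.
suff : (copula_law C (`[0%R, 1%R]%classic `*` `[0%R, x]%classic) <=
    copula_law C (A `|` B))%E.
  by rewrite cAB copula_cdf// copula_margin2// lee_fin; lra.
apply: (@graph_copula_law_le _ T C _ _ 2) => //; try exact: measurable_rectangle.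
  exact: measurableU.
move=> y y01 _ [/=]; rewrite !in_itv/= => _ /andP[Ty0 Tyx].
have [Tyv|Tyv] := leP (T y) v; first by right; split; rewrite /= ?in_itv/= ?y01 ?Ty0.
left; split; rewrite /= ?in_itv/= ?Ty0//.
case/andP: (y01) => -> _ /=; rewrite -[y]TK; apply: HL2 => //.
by rewrite -vE.
Qed.

(** * Extremal involutions *)

Ltac split_thresholds x :=
  repeat match goal with
  | |- context [if (x < ?b)%R then _ else _] => case: (ltP x b) => ? /=
  | |- context [if (x <= ?b)%R then _ else _] => case: (leP x b) => ? /=
  end.

(** A comparison already settled by the context is resolved by [lra] without branching; a case split
    is the last resort. *)
Ltac decide_compare :=
  repeat match goal with
  | |- context [if (?a < ?b)%R then _ else _] =>
      first
        [ let H := fresh in (have H : (a < b)%R by lra); rewrite H {H} /=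
        | let H := fresh in (have H : (b <= a)%R by lra); rewrite (ltNge a b) H {H} /=
        | case: (ltP a b) => ? /= ]
  | |- context [if (?a <= ?b)%R then _ else _] =>
      first
        [ let H := fresh in (have H : (a <= b)%R by lra); rewrite H {H} /=
        | let H := fresh in (have H : (b < a)%R by lra); rewrite (leNgt a b) H {H} /=
        | case: (leP a b) => ? /= ]
  end.

(* The pieces of the involution for the upper bound exchange [1/2-2s-m, 1/2-s-m)
   with [1/2-s, 1/2), [1/2-s-m, 1/2-s) with [1/2+s, 1/2+s+m), and [1/2, 1/2+s)
   with [1/2+s+m, 1/2+2s+m), each time by a translation.  The mass crossing the
   level 1/2 upwards is m. *)
Definition upper_piece {R : realType} (m s : R) (x : R) : nat :=
  if x < 1 / 2 - 2 * s - m then 0%N else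
  if x < 1 / 2 - s - m then 1%N else
  if x < 1 / 2 - s then 3%N else
  if x < 1 / 2 then 2%N else
  if x < 1 / 2 + s then 1%N else
  if x < 1 / 2 + s + m then 4%N else
  if x < 1 / 2 + 2 * s + m then 2%N else 0%N.

(** Labels 1 and 2 serve two exchanges, one on each side of 1/2, because both are translations by m
    + s; labels 3 and 4 carry the exchange across 1/2. *)
Definition upper_tab {R : realType} (m s : R) (k : nat) : bool * R :=
  (false, nth 0 [:: 0; m + s; - (m + s); m + 2 * s; - (m + 2 * s)] k).

Definition upper_swap (k : nat) : nat := nth 0%N [:: 0; 2; 1; 4; 3]%N k.

Definition upper_map {R : realType} (m s : R) : R -> R :=
  piecewise_isometry (upper_piece m s) (upper_tab m s).

Lemma measurable_fun_ifnat (R : realType) (b : R -> bool) (f g : R -> nat) :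
  measurable_fun setT b -> measurable_fun setT f -> measurable_fun setT g ->
  measurable_fun setT (fun x => if b x then f x else g x).
Proof. by move=> mb mf mg; apply: measurable_fun_ifT. Qed.

Lemma upper_reversible (R : realType) (m s : R) : 0 <= m -> 0 <= s ->
  reversible_pieces 5 (upper_piece m s) (upper_tab m s) upper_swap.
Proof.
move=> m0 s0; split.
- by move=> x; rewrite /upper_piece; split_thresholds x.
- do 7 (apply: measurable_fun_ifnat; [exact: measurable_fun_ltr|by []|]).
  by [].
- by move=> [|[|[|[|[|]]]]].
- by move=> [|[|[|[|[|]]]]].
- by move=> [|[|[|[|[|]]]]]//= x _; rewrite /isometry/=; ring.
- move=> x; rewrite /piecewise_isometry /isometry /upper_piece.
  by rewrite /upper_tab /upper_swap; split_thresholds x; decide_compare.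
Qed.

Lemma upper_map01 (R : realType) (m s x : R) :
  0 <= m -> 0 <= s -> 2 * s + m <= 1 / 2 ->
  0 <= x <= 1 -> 0 <= upper_map m s x <= 1.
Proof.
move=> m0 s0 sm /andP[x0 x1].
rewrite /upper_map /piecewise_isometry /isometry /upper_piece /upper_tab.
by split_thresholds x; apply/andP; split; lra.
Qed.

(** Every point not moved to the left is a record of the map, as for weak excedances of a
    321-avoiding permutation. *)
Lemma upper_map_shape (R : realType) (m s x y : R) : 0 <= m -> 0 <= s ->
  x <= upper_map m s x -> y <= x -> upper_map m s y <= upper_map m s x.
Proof.
move=> m0 s0; rewrite /upper_map /piecewise_isometry /isometry /upper_piece /upper_tab.
split_thresholds x => xT; try (exfalso; lra); split_thresholds y => yx; lra.
Qed.

(* The involution for the lower bound reflects [1/2-t, 1/2] and [1/2, 1/2+t] onto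
   themselves and exchanges the two blocks of length m next to them by
   [x |-> 1 - x]. *)
Definition lower_piece {R : realType} (m t : R) (x : R) : nat :=
  if x < 1 / 2 - t - m then 0%N else
  if x < 1 / 2 - t then 3%N else
  if x <= 1 / 2 - t then 0%N else
  if x < 1 / 2 then 2%N else
  if x <= 1 / 2 + t then 1%N else
  if x <= 1 / 2 + t + m then 3%N else 0%N.

Definition lower_tab {R : realType} (t : R) (k : nat) : bool * R :=
  nth (false, 0) [:: (false, 0); (true, 1 + t); (true, 1 - t); (true, 1)] k.

Definition lower_map {R : realType} (m t : R) : R -> R :=
  piecewise_isometry (lower_piece m t) (lower_tab t).

(** A reflection turns a closed left end into a closed right end, hence the mixture of strict and
    weak thresholds. The point 1/2 - t is left fixed because its mirror image 1/2 already belongs to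
    the right-hand reflection. Each cell is its own partner, so the label involution is the
    identity. *)
Lemma lower_reversible (R : realType) (m t : R) : 0 <= m -> 0 <= t ->
  reversible_pieces 4 (lower_piece m t) (lower_tab t) id.
Proof.
move=> m0 t0; split=> //.
- by move=> x; rewrite /lower_piece; split_thresholds x.
- do 6 (apply: measurable_fun_ifnat;
    [exact: measurable_fun_ltr || exact: measurable_fun_ler|by []|]).
  by [].
- by move=> [|[|[|[|]]]]//= x _; rewrite /isometry/=; ring.
- move=> x; rewrite /piecewise_isometry /isometry /lower_piece /lower_tab.
  by split_thresholds x; decide_compare.
Qed.

Lemma lower_map01 (R : realType) (m t x : R) :
  0 <= m -> 0 <= t -> t + m <= 1 / 2 ->
  0 <= x <= 1 -> 0 <= lower_map m t x <= 1.
Proof.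
move=> m0 t0 tm /andP[x0 x1].
rewrite /lower_map /piecewise_isometry /isometry /lower_piece /lower_tab.
by split_thresholds x; apply/andP; split; lra.
Qed.

(** Join each point to its image by an arc: y < x < T y <= T x would make two arcs cross. The
    companion [lower_map_shape2] excludes the crossing T x < z < x < T z. *)
Lemma lower_map_shape1 (R : realType) (m t x y : R) : 0 <= m -> 0 <= t ->
  x <= lower_map m t x -> y < x -> lower_map m t y <= lower_map m t x ->
  lower_map m t y <= x.
Proof.
move=> m0 t0.
rewrite /lower_map /piecewise_isometry /isometry /lower_piece /lower_tab.
split_thresholds x => xT; try (exfalso; lra); split_thresholds y => yx Ty; lra.
Qed.

Lemma lower_map_shape2 (R : realType) (m t x z : R) : 0 <= m -> 0 <= t ->
  lower_map m t x < z -> z <= x -> lower_map m t z <= x.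
Proof.
move=> m0 t0.
rewrite /lower_map /piecewise_isometry /isometry /lower_piece /lower_tab.
split_thresholds x; split_thresholds z => xz zx; lra.
Qed.

(** C(u, v) is the length of the set of x in [0, 1] with x <= u and T x <= v, and [l] presents the
    indicator of that set. *)
Lemma graph_copula_rectangle (R : realType) (T : R -> R) (C : copula R)
    (u v : R) (E : seq R) (l : seq (R * R * R)) :
  measurable_fun setT (T : measurableTypeR R -> measurableTypeR R) ->
  (forall x, 0 <= x <= 1 -> 0 <= T x <= 1) ->
  is_graph_copula T C -> 0 <= u <= 1 -> 0 <= v <= 1 ->
  all (fun h => 0 <= h.1.1 <= 1) l ->
  (forall x, 0 <= x <= 1 -> x \notin E ->
    (if (x <= u) && (T x <= v) then 1 else 0) = step_affine l x) ->
  C u v = \sum_(h <- l) (h.1.2 * (1 - h.1.1 ^+ 2) / 2 + h.2 * (1 - h.1.1)).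
Proof.
move=> mT T01 CT u01 v01 l01 ml.
have mG : measurable_fun setT (graph_of T) by exact: measurable_fun_pair.
pose S := graph_of T @^-1` (`[0, u]%classic `*` `[0, v]%classic).
have mS : measurable S.
  by rewrite -[X in measurable X]setTI; apply: mG => //; exact: measurable_rectangle.
rewrite -(@integral_eq_step_affine _ (\1_S) E l)//.
- rewrite -[LHS]/(fine (C u v)%:E) -copula_cdf// CT; last exact: measurable_rectangle.
  by rewrite /Rintegral integral_indic.
- move=> x x01 xE; rewrite -ml// indicE.
  have -> : x \in S = (x <= u) && (T x <= v).
    have /andP[Tx0 _] := T01 x x01; case/andP: x01 => x0 _.
    apply/idP/andP.
      by rewrite inE => -[/=]; rewrite !in_itv/= => /andP[_ xu] /andP[_ Tv].
    by move=> [xu Tv]; rewrite inE; split; rewrite /= in_itv/= ?x0 ?Tx0.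
  by case: (x <= u) => //=; case: (T x <= v).
Qed.

(** The entries are increments: min(x, T x) equals x except on the blocks moved to the left, where
    it falls short of x by the length of the translation. *)
Definition upper_min_steps {R : realType} (m s : R) : seq (R * R * R) :=
  [:: (0, 1, 0); (1 / 2 - s, 0, - (m + s)); (1 / 2, 0, m + s);
      (1 / 2 + s, 0, - (m + 2 * s)); (1 / 2 + s + m, 0, s);
      (1 / 2 + 2 * s + m, 0, m + s)].

Lemma upper_minE (R : realType) (m s x : R) :
  0 <= m -> 0 <= s -> 2 * s + m <= 1 / 2 -> 0 <= x ->
  Num.min x (upper_map m s x) = step_affine (upper_min_steps m s) x.
Proof.
move=> m0 s0 sm x0; rewrite /step_affine !big_cons big_nil /= x0.
rewrite /upper_map /piecewise_isometry /isometry /upper_piece /upper_tab.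
by split_thresholds x; rewrite minEle; decide_compare; lra.
Qed.

(** The indicator of [0, a) and [b, 1/2). Up to finitely many points, the block [a, b) of length m
    is the part of [0, 1/2] that the extremal maps send above 1/2. *)
Definition quadrant_steps {R : realType} (a b : R) : seq (R * R * R) :=
  [:: (0, 0, 1); (a, 0, -1); (b, 0, 1); (1 / 2, 0, -1)].

(** Both excluded points matter only for s = 0: the map then exchanges 1/2 - m and 1/2, and the
    closed quadrant counts both. *)
Lemma upper_quadrantE (R : realType) (m s x : R) :
  0 <= m -> 0 <= s -> 2 * s + m <= 1 / 2 -> 0 <= x ->
  x \notin [:: 1 / 2; 1 / 2 - s - m] ->
  (if (x <= 1 / 2) && (upper_map m s x <= 1 / 2) then 1 else 0) =
  step_affine (quadrant_steps (1 / 2 - s - m) (1 / 2 - s)) x.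
Proof.
move=> m0 s0 sm x0; rewrite /step_affine !big_cons big_nil /= x0.
rewrite /upper_map /piecewise_isometry /isometry /upper_piece /upper_tab.
split_thresholds x; rewrite if_and; decide_compare; first [by move=> _; lra |
  by rewrite !inE negb_or !neq_lt => /andP[/orP[?|?] /orP[?|?]]; lra].
Qed.

(** The footrule is 1 minus three times the mean displacement: blocks of total length 4s move by m +
    s, and two of length m move by m + 2s. *)
Lemma upper_copula (R : realType) (m s : R) :
  0 <= m -> 0 <= s -> 2 * s + m <= 1 / 2 ->
  exists C : copula R, [/\
    kendall_tau C = spearman_footrule C + (1 - spearman_footrule C) / 3,
    spearman_footrule C = 1 - 6 * (m ^+ 2 + 4 * m * s + 2 * s ^+ 2) &
    blomqvist_beta C = 1 - 4 * m].
Proof.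
move=> m0 s0 sm; have H := upper_reversible m0 s0.
have mT := measurable_piecewise_isometry H.
have T01 x := @upper_map01 _ m s x m0 s0 sm.
have TK := piecewise_isometryK H.
have [C CT] := graph_copula mT T01 TK (lebesgue_piecewise_isometry H).
exists C; split.
- apply: (graph_copula_upper mT T01 TK CT).
  by move=> x y; exact: upper_map_shape.
- rewrite /spearman_footrule (integral_graph mT T01 CT).
  rewrite (@integral_eq_step_affine _ _ [::] (upper_min_steps m s)).
  + by rewrite !big_cons big_nil /=; field.
  + by rewrite /=; repeat (apply/andP; split) => //; lra.
  + by apply: measurable_minr => //; exact: measurable_funTS.
  by move=> x /andP[x0 _] _; exact: upper_minE.
- rewrite /blomqvist_beta (@graph_copula_rectangle _ _ _ _ _
    [:: 1 / 2; 1 / 2 - s - m]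
    (quadrant_steps (1 / 2 - s - m) (1 / 2 - s)) mT T01 CT).
  + by rewrite !big_cons big_nil /=; field.
  + by lra.
  + by lra.
  + by rewrite /=; repeat (apply/andP; split) => //; lra.
  by move=> x /andP[x0 _]; exact: upper_quadrantE.
Qed.

(** The breakpoints 1/2 - t/2 and 1/2 + t/2 are the centres of the two inner reflections, where
    min(x, T x) switches between x and T x. *)
Definition lower_min_steps {R : realType} (m t : R) : seq (R * R * R) :=
  [:: (0, 1, 0); (1 / 2 - t / 2, -2, 1 - t); (1 / 2, 2, t - 1);
      (1 / 2 + t / 2, -2, 1 + t); (1 / 2 + t, 0, - t); (1 / 2 + t + m, 2, -1)].

Lemma lower_minE (R : realType) (m t x : R) :
  0 <= m -> 0 <= t -> t + m <= 1 / 2 -> 0 <= x ->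
  x \notin [:: 1 / 2 + t; 1 / 2 + t + m] ->
  Num.min x (lower_map m t x) = step_affine (lower_min_steps m t) x.
Proof.
move=> m0 t0 tm x0; rewrite /step_affine !big_cons big_nil /= x0.
rewrite /lower_map /piecewise_isometry /isometry /lower_piece /lower_tab.
split_thresholds x; rewrite minEle; decide_compare; first [by move=> _; lra |
  by rewrite !inE negb_or !neq_lt => /andP[/orP[?|?] /orP[?|?]]; lra].
Qed.

Lemma lower_quadrantE (R : realType) (m t x : R) :
  0 <= m -> 0 <= t -> t + m <= 1 / 2 -> 0 <= x -> x \notin [:: 1 / 2] ->
  (if (x <= 1 / 2) && (lower_map m t x <= 1 / 2) then 1 else 0) =
  step_affine (quadrant_steps (1 / 2 - t - m) (1 / 2 - t)) x.
Proof.
move=> m0 t0 tm x0; rewrite /step_affine !big_cons big_nil /= x0.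
rewrite /lower_map /piecewise_isometry /isometry /lower_piece /lower_tab.
split_thresholds x; rewrite if_and; decide_compare; first [by move=> _; lra |
  by rewrite inE neq_lt => /orP[?|?]; lra].
Qed.

(** Here each inner reflection contributes t^2/2 to the mean displacement, and the outer exchange
    contributes 2((t + m)^2 - t^2). *)
Lemma lower_copula (R : realType) (m t : R) :
  0 <= m -> 0 <= t -> t + m <= 1 / 2 ->
  exists C : copula R, [/\
    kendall_tau C = spearman_footrule C - (1 - spearman_footrule C) / 3,
    spearman_footrule C = 1 - 6 * (m ^+ 2 + 2 * m * t + t ^+ 2 / 2) &
    blomqvist_beta C = 1 - 4 * m].
Proof.
move=> m0 t0 tm; have H := lower_reversible m0 t0.
have mT := measurable_piecewise_isometry H.
have T01 x := @lower_map01 _ m t x m0 t0 tm.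
have TK := piecewise_isometryK H.
have [C CT] := graph_copula mT T01 TK (lebesgue_piecewise_isometry H).
exists C; split.
- apply: (graph_copula_lower mT T01 TK CT).
    by move=> x y; exact: lower_map_shape1.
  by move=> x y; exact: lower_map_shape2.
- rewrite /spearman_footrule (integral_graph mT T01 CT).
  rewrite (@integral_eq_step_affine _ _ [:: 1 / 2 + t; 1 / 2 + t + m]
    (lower_min_steps m t)).
  + by rewrite !big_cons big_nil /=; field.
  + by rewrite /=; repeat (apply/andP; split) => //; lra.
  + by apply: measurable_minr => //; exact: measurable_funTS.
  by move=> x /andP[x0 _]; exact: lower_minE.
- rewrite /blomqvist_beta (@graph_copula_rectangle _ _ _ _ _ [:: 1 / 2]
    (quadrant_steps (1 / 2 - t - m) (1 / 2 - t)) mT T01 CT).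
  + by rewrite !big_cons big_nil /=; field.
  + by lra.
  + by lra.
  + by rewrite /=; repeat (apply/andP; split) => //; lra.
  by move=> x /andP[x0 _]; exact: lower_quadrantE.
Qed.

(** * Mixtures *)

Section mixture.
Context (R : realType) (C0 C1 : copula R) (a : R).
Context (a0 : 0 <= a) (b0 : 0 <= 1 - a).

Definition mixture_law : set (square_space R) -> \bar R :=
  measure_add (mscale (NngNum b0) (copula_law C0))
              (mscale (NngNum a0) (copula_law C1)).

HB.instance Definition _ := Measure.on mixture_law.

Lemma mixture_lawE A :
  mixture_law A = ((1 - a)%:E * copula_law C0 A + a%:E * copula_law C1 A)%E.
Proof. exact: measure_addE. Qed.

Lemma mixture_law_setT : mixture_law setT = 1%E.
Proof. by rewrite mixture_lawE !probability_setT !mule1 -EFinD subrK. Qed.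

HB.instance Definition _ :=
  @Measure_isProbability.Build _ _ R mixture_law mixture_law_setT.

End mixture.

Lemma mixture_copula (R : realType) (C0 C1 : copula R) (a : R) : 0 <= a <= 1 ->
  exists C : copula R, forall A : set (square_space R), measurable A ->
    copula_law C A = ((1 - a)%:E * copula_law C0 A + a%:E * copula_law C1 A)%E.
Proof.
move=> /andP[a0 a1]; have b0 : 0 <= 1 - a by rewrite subr_ge0.
have comb (x : R) : ((1 - a)%:E * x%:E + a%:E * x%:E)%E = x%:E.
  by rewrite -!EFinM -EFinD; congr EFin; ring.
have le11 : 0 <= (1 : R) <= 1 by rewrite ler01 lexx.
have [|u u01|v v01|C CE] := @copula_of_law _ (mixture_law C0 C1 a0 b0).
- by rewrite [LHS]mixture_lawE !copula_law_square comb.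
- by rewrite [LHS]mixture_lawE !copula_cdf// !copula_margin1// comb.
- by rewrite [LHS]mixture_lawE !copula_cdf// !copula_margin2// comb.
- by exists C => A mA; rewrite CE; exact: mixture_lawE.
Qed.

Lemma mixture_copulaE (R : realType) (C0 C1 C : copula R) (a u v : R) :
  (forall A : set (square_space R), measurable A ->
    copula_law C A = ((1 - a)%:E * copula_law C0 A + a%:E * copula_law C1 A)%E) ->
  0 <= u <= 1 -> 0 <= v <= 1 -> C u v = (1 - a) * C0 u v + a * C1 u v.
Proof.
move=> CE u01 v01; apply: EFin_inj; rewrite -copula_cdf// CE.
  by rewrite !copula_cdf// -!EFinM -EFinD.
exact: measurable_rectangle.
Qed.

(** Nonnegativity of [f] gives additivity in the measure for extended integrals; the bound [K] makes
    them finite, so that [fine] respects sum and product. *)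
Lemma integral_mixture (R : realType) (C0 C1 C : copula R) (a : R)
    (f : square_space R -> R) (K : R) : 0 <= a <= 1 ->
  (forall A : set (square_space R), measurable A ->
    copula_law C A = ((1 - a)%:E * copula_law C0 A + a%:E * copula_law C1 A)%E) ->
  measurable_fun (@unit_square R : set (square_space R)) f ->
  (forall w, unit_square w -> 0 <= f w <= K) ->
  \int[copula_law C]_(w in @unit_square R) f w =
  (1 - a) * \int[copula_law C0]_(w in @unit_square R) f w +
  a * \int[copula_law C1]_(w in @unit_square R) f w.
Proof.
move=> /andP[a0 a1] CE mf f0K; have b0 : 0 <= 1 - a by rewrite subr_ge0.
have int (D : copula R) : (copula_law D).-integrable (@unit_square R) (EFin \o f).
  apply: (@unit_square_integrable _ _ _ K) => // w /f0K /andP[f0 fK].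
  by rewrite ger0_norm.
have mS := @measurable_unit_square R.
have fin (D : copula R) :
    (\int[copula_law D]_(w in @unit_square R) (f w)%:E)%E \is a fin_num.
  exact: (integrable_fin_num mS (int D)).
have f0 w : unit_square w -> (0 <= (f w)%:E)%E.
  by move=> /f0K /andP[f0 _]; rewrite lee_fin.
have mEf : measurable_fun (@unit_square R : set (square_space R)) (EFin \o f).
  exact/measurable_EFinP.
pose m := measure_add (mscale (NngNum b0) (copula_law C0))
                      (mscale (NngNum a0) (copula_law C1)).
rewrite /Rintegral.
have -> : (\int[copula_law C]_(w in @unit_square R) (f w)%:E =
    \int[m]_(w in @unit_square R) (f w)%:E)%E.
  by apply: eq_measure_integral => A mA _; apply: (etrans (CE A mA)); exact/esym/measure_addE.
rewrite /m ge0_integral_measure_add// !ge0_integral_mscale//.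
by rewrite fineD ?fin_numM ?fin// fineM ?fin// fineM ?fin.
Qed.

Lemma spearman_footrule_mixture (R : realType) (C0 C1 C : copula R) (a : R) :
  (forall A : set (square_space R), measurable A ->
    copula_law C A = ((1 - a)%:E * copula_law C0 A + a%:E * copula_law C1 A)%E) ->
  spearman_footrule C =
  (1 - a) * spearman_footrule C0 + a * spearman_footrule C1.
Proof.
move=> CE; rewrite /spearman_footrule.
have -> : \int[lebesgue_measure]_(u in `[0, 1]) C u u =
    \int[lebesgue_measure]_(u in `[0, 1]) ((1 - a) * C0 u u + a * C1 u u).
  apply: eq_Rintegral => u; rewrite inE/= in_itv/= => u01.
  exact: mixture_copulaE.
have mI : measurable (`[0, 1]%classic : set (measurableTypeR R)) by exact: measurable_itv.
have i0 := integrable_diagonal C0; have i1 := integrable_diagonal C1.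
have j0 : lebesgue_measure.-integrable `[0, 1]
    (EFin \o (fun u => (1 - a) * C0 u u)) by exact: (integrableZl mI (1 - a) i0).
have j1 : lebesgue_measure.-integrable `[0, 1]
    (EFin \o (fun u => a * C1 u u)) by exact: (integrableZl mI a i1).
by rewrite (RintegralD mI j0 j1) (RintegralZl _ mI i0) (RintegralZl _ mI i1); ring.
Qed.

Lemma blomqvist_beta_mixture (R : realType) (C0 C1 C : copula R) (a : R) :
  (forall A : set (square_space R), measurable A ->
    copula_law C A = ((1 - a)%:E * copula_law C0 A + a%:E * copula_law C1 A)%E) ->
  blomqvist_beta C = (1 - a) * blomqvist_beta C0 + a * blomqvist_beta C1.
Proof.
move=> CE; rewrite /blomqvist_beta (mixture_copulaE CE); first by ring.
  by lra.
by lra.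
Qed.

(** Separating the integrating law from the integrand gives a form that is affine in each argument
    under mixing; Kendall's tau comes from its diagonal, which is therefore quadratic along a
    segment. *)
Definition concordance {R : realType} (C D : copula R) : R :=
  \int[copula_law C]_(w in @unit_square R) D w.1 w.2.

Lemma concordance_mixture (R : realType) (C0 C1 C : copula R) (a : R) :
  0 <= a <= 1 ->
  (forall A : set (square_space R), measurable A ->
    copula_law C A = ((1 - a)%:E * copula_law C0 A + a%:E * copula_law C1 A)%E) ->
  concordance C C = (1 - a) ^+ 2 * concordance C0 C0 +
    a * (1 - a) * (concordance C0 C1 + concordance C1 C0) +
    a ^+ 2 * concordance C1 C1.
Proof.
move=> a01 CE.
have lin (D : copula R) :
    concordance D C = (1 - a) * concordance D C0 + a * concordance D C1.
  have int (D' : copula R) : (copula_law D).-integrable (@unit_square R)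
      (EFin \o (fun w : square_space R => D' w.1 w.2)).
    apply: (@unit_square_integrable _ _ _ 1); first exact: measurable_copula.
    move=> w [/=]; rewrite !in_itv/= => w1 w2.
    rewrite ger0_norm ?copula_ge0// (le_trans (copula_le1 D' w1 w2))//.
    by case/andP: w1.
  rewrite /concordance.
  have -> : \int[copula_law D]_(w in @unit_square R) C w.1 w.2 =
    \int[copula_law D]_(w in @unit_square R)
      ((1 - a) * C0 w.1 w.2 + a * C1 w.1 w.2).
    apply: eq_Rintegral => w; rewrite inE => -[/=]; rewrite !in_itv/= => w1 w2.
    exact: mixture_copulaE.
  have mS := @measurable_unit_square R.
  have j0 : (copula_law D).-integrable (@unit_square R)
      (EFin \o (fun w : square_space R => (1 - a) * C0 w.1 w.2)).
    exact: (integrableZl mS (1 - a) (int C0)).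
  have j1 : (copula_law D).-integrable (@unit_square R)
      (EFin \o (fun w : square_space R => a * C1 w.1 w.2)).
    exact: (integrableZl mS a (int C1)).
  by rewrite (RintegralD mS j0 j1) (RintegralZl _ mS (int C0)) (RintegralZl _ mS (int C1)).
rewrite {1}/concordance (@integral_mixture _ C0 C1 C a _ 1)//.
- by rewrite -!/(concordance _ _) !lin; ring.
- exact: measurable_copula.
- move=> w [/=]; rewrite !in_itv/= => w1 w2.
  rewrite copula_ge0//= (le_trans (copula_le1 C w1 w2))//.
  by case/andP: w1.
Qed.

Lemma kendall_tauE (R : realType) (C : copula R) :
  kendall_tau C = 4 * concordance C C - 1.
Proof. by []. Qed.

Lemma kendall_tau_intermediate (R : realType) (C0 C1 : copula R) (t : R) :
  kendall_tau C0 <= t <= kendall_tau C1 ->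
  spearman_footrule C0 = spearman_footrule C1 ->
  blomqvist_beta C0 = blomqvist_beta C1 ->
  exists C : copula R, [/\ kendall_tau C = t,
    spearman_footrule C = spearman_footrule C0 &
    blomqvist_beta C = blomqvist_beta C0].
Proof.
rewrite !kendall_tauE => /andP[t0 t1] p01 b01.
pose x := concordance C0 C0; pose z := concordance C1 C1.
pose y := concordance C0 C1 + concordance C1 C0.
(* [P] is the concordance of the mixture with weight [a] minus (t + 1)/4, the concordance value for
   which tau equals t. It is nonpositive at 0 and nonnegative at 1. *)
pose P : {poly R} := (x - (t + 1) / 4)%:P + (y - 2 * x) *: 'X + (x - y + z) *: ('X * 'X).
have PE a : P.[a] = (1 - a) ^+ 2 * x + a * (1 - a) * y + a ^+ 2 * z - (t + 1) / 4.
  by rewrite /P !hornerD !hornerZ hornerM hornerX hornerC; ring.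
have [||a a01 /rootP] := @poly_ivt _ P 0 1; first exact: ler01.
  by rewrite !PE; apply/andP; split; rewrite /x /z; lra.
rewrite PE => Pa.
have [C CE] := mixture_copula C0 C1 a01.
exists C; split.
- rewrite kendall_tauE (concordance_mixture a01 CE) -/x -/z -/y; lra.
- by rewrite (spearman_footrule_mixture CE) -p01; ring.
- by rewrite (blomqvist_beta_mixture CE) -b01; ring.
Qed.

(** * The fibres of [Omega] and its reflection *)

Lemma extremal_copulas (R : realType) (p b : R) : admissible p b ->
  (exists C : copula R, [/\ kendall_tau C = p - (1 - p) / 3,
    spearman_footrule C = p & blomqvist_beta C = b]) /\
  (exists C : copula R, [/\ kendall_tau C = p + (1 - p) / 3,
    spearman_footrule C = p & blomqvist_beta C = b]).
Proof.
move=> [/andP[b1 b2] /andP[p1 p2]].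
(* [m] is forced by beta, and [D] is the mean displacement forced by the footrule. Solving D = r^2 -
   2m^2 for r makes the block sizes r - 2m and r/2 - m linear in r. *)
pose m := (1 - b) / 4; pose D := (1 - p) / 3.
have m0 : 0 <= m by rewrite /m; lra.
have Dm : 0 <= D + 2 * m ^+ 2 by rewrite /D /m; nra.
pose r := Num.sqrt (D + 2 * m ^+ 2).
have r0 : 0 <= r by exact: sqrtr_ge0.
have r2 : r ^+ 2 = D + 2 * m ^+ 2 by rewrite sqr_sqrtr.
have rm : 2 * m <= r.
  by rewrite -(@ler_pXn2r _ 2) ?nnegrE// ?r2 /D /m; lra.
have rM : r <= 1 / 2 + m.
  by rewrite -(@ler_pXn2r _ 2) ?nnegrE// ?r2 /D /m; lra.
have pE : p = 1 - 3 * (r ^+ 2 - 2 * m ^+ 2) by rewrite r2 /D; field.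
have bE : b = 1 - 4 * m by rewrite /m; field.
split.
  have [|||C [Ct Cp Cb]] := @lower_copula _ m (r - 2 * m) => //; try lra.
  have Cp' : spearman_footrule C = p by rewrite Cp pE; field.
  by exists C; split => //; [rewrite Ct Cp'|rewrite Cb bE].
have [|||C [Ct Cp Cb]] := @upper_copula _ m (r / 2 - m) => //; try lra.
have Cp' : spearman_footrule C = p by rewrite Cp pE; field.
by exists C; split => //; [rewrite Ct Cp'|rewrite Cb bE].
Qed.

Lemma Omega_fibreE (R : realType) (p b : R) : admissible p b ->
  Omega_fibre p b = `[p - (1 - p) / 3, p + (1 - p) / 3]%classic.
Proof.
move=> pb; apply/seteqP; split=> t; rewrite /Omega_fibre /Omega/= in_itv/=.
  by move=> [C _ [<- <- _]]; exact: kendall_tau_footrule_bounds.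
have [[C0 [t0 p0 b0]] [C1 [t1 p1 b1]]] := extremal_copulas pb.
move=> tI; have [|||C [Ct Cp Cb]] := @kendall_tau_intermediate _ C0 C1 t.
- by rewrite t0 t1.
- by rewrite p0 p1.
- by rewrite b0 b1.
by exists C => //; rewrite Ct Cp Cb p0 b0.
Qed.

Unset Implicit Arguments.

Theorem mainTheorem3 (R : realType) :
  (forall p b : R, admissible p b ->
     [/\ Omega_fibre p b = `[p - (1 - p) / 3, p + (1 - p) / 3]%classic,
         (forall t : R, Omega_fibre p b t <-> Omega_fibre p b (2 * p - t)) &
         lebesgue_measure (Omega_fibre p b) = (2 / 3 * (1 - p))%:E]) /\
  (forall p b : R, admissible p b ->
     exists C : copula R,
       [/\ kendall_tau C = p, spearman_footrule C = p
         & blomqvist_beta C = b]) /\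
  (involutive (@tau_reflection R) /\
   @tau_reflection R @` @Omega R = @Omega R).
Proof.
have p1 (p b : R) : admissible p b -> p <= 1 by
  move=> [_ /andP[_ h]]; have := sqr_ge0 (1 - b); lra.
have sym (p b : R) : admissible p b ->
    forall t : R, Omega_fibre p b t -> Omega_fibre p b (2 * p - t).
  move=> pb t; rewrite Omega_fibreE//= !in_itv/= => /andP[h1 h2].
  by apply/andP; split; lra.
have reflK : involutive (@tau_reflection R).
  by move=> [[t p] b] /=; congr (_, _, _); ring.
(* By [copula_admissible], every point of [Omega] lies over an admissible pair, hence in a fibre
   already known to be a full interval symmetric about p. *)
have refl_Omega (w : R * R * R) : Omega w -> Omega (tau_reflection w).
  move=> [C _ <-] /=; apply: (sym _ _ (copula_admissible C)).
  by exists C.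
split; last split.
- move=> p b pb; split; first exact: Omega_fibreE.
    move=> t; split; first exact: sym.
    by move=> /(sym _ _ pb); rewrite opprB addrC subrK.
  rewrite Omega_fibreE// lebesgue_itvcc; last by have := p1 _ _ pb; lra.
  by congr EFin; field.
- move=> p b pb; have : Omega_fibre p b p.
    rewrite Omega_fibreE//= in_itv/=; have := p1 _ _ pb => p1'.
    by apply/andP; split; lra.
  by move=> [C _ [Ct Cp Cb]]; exists C.
- split => //; apply/seteqP; split => w; first by move=> [w' Ow' <-]; exact: refl_Omega.
  by move=> Ow; exists (tau_reflection w); [exact: refl_Omega|rewrite reflK].
Qed.
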